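(* Let $F$ be a $\theta$-field with field of constants $K$ (setting as in the context), let $R$ be a PPV-ring over $F$ and let $\mathcal G=\underline{\mathrm{Gal}}(R/F)$ be its Galois group scheme, with $\mathcal G_F=\mathcal G\times_KF$. Then $\mathrm{Spec}(R)$, with the natural action of $\mathcal G_F$, is a $\mathcal G_F$-torsor.
   Context: Cgas and higher derivations. For a commutative ring $S$, an $S$-cga is the completion $B$ of a graded commutative $S$-algebra $\bigoplus_{i\ge0}B_i$ with $B_0=S$, with respect to the filtration by the ideals $\bigoplus_{i\ge k}B_i$ (so $B=\prod_iB_i$). For an $S$-algebra $S'$, $S'\otimes B$ denotes the $S'$-cga with homogeneous components $S'\otimes_SB_k$. A continuous additive map $g:B\to B$ is positive if it never lowers degree; $g^{(i)}$ is its part raising degree by $i$. Let $K$ be a field. A higher derivation over $K$ of a $K$-algebra $S$ into an $S$-cga $B$ is a $K$-algebra homomorphism $\theta:S\to B$ whose degree-$0$ component is $\mathrm{id}_S$; $\theta^{(k)}:S\to B_k$ is its degree-$k$ component. It is iterable if (1) the graded $S$-algebra $\bigoplus_kB_k$ is generated by the elements $\theta^{(k)}(r)$, $k\ge0$, $r\in S$; and (2) $\theta$ extends to a positive continuous $K$-algebra endomorphism $\theta_B$ of $B$ with $\theta_B^{(i)}\circ\theta_B^{(j)}=\binom{i+j}{i}\theta_B^{(i+j)}$ for all $i,j\ge0$. Setting. $K$ is a field, $F$ a field containing $K$, $\tilde\Omega$ an $F$-cga without zero divisors, $\theta:F\to\tilde\Omega$ an iterable higher derivation over $K$ with $K=\{t\in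 F\mid\theta(t)=t\}$. $\theta$-rings. A $\theta$-ring is a (commutative) $F$-algebra $R$ with an iterable higher derivation $\theta_R:R\to R\otimes\tilde\Omega$ extending $\theta$. Its ring of constants is $C_R=\{r\mid\theta_R(r)=r\otimes1\}$. An ideal $I$ is a $\theta$-ideal if $\theta_R^{(k)}(I)\subseteq I\otimes_F\tilde\Omega_k$ for all $k$; $R$ is $\theta$-simple if it has no proper nontrivial $\theta$-ideals. For a $K$-algebra $L$, put $R_L=R\otimes_KL$, $F_L=F\otimes_KL$, with $\theta$ extended trivially: $\theta(r\otimes a)=\theta_R(r)\otimes a$. PPV-rings. An iterable higher differential equation over $F$ is an equation $\theta(y)=Ay$ with $A=\sum_kA_k\in\mathrm{GL}_n(\tilde\Omega)$, $A_k\in\mathrm{Mat}_n(\tilde\Omega_k)$, $A_0=1_n$, and $\binom{k+l}{l}A_{k+l}=\sum_{i+j=l}\theta_{\tilde\Omega}^{(i)}(A_k)A_j$ for all $k,l\ge0$. A $\theta$-ring $R$ is a PPV-ring over $F$ for this equation if: $R$ is $\theta$-simple; there is $Y\in\mathrm{GL}_n(R)$ with $\theta_R(Y)=AY$; $R$ is generated as an $F$-algebra by the entries of $Y$ and $\det(Y)^{-1}$; and $C_R=C_F=K$. ''PPV-ring over $F$'' means PPV-ring for some such equation. Galois group scheme. $\underline{\mathrm{Gal}}(R/F)$ is the affine $K$-group scheme of finite type representing the functor on $K$-algebras $L\mapsto\mathrm{Aut}^\theta(R_L/F_L)$, the group of $F_L$-linear ring automorphisms of $R_L$ commuting with $\theta$.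 The natural action of the universal point gives a coaction $\rho:R\to R\otimes_KK[\mathcal G]$, i.e. an action of $\mathcal G_F$ on $\mathrm{Spec}(R)$ over $F$. *)

(* Defs.v *)
From HB Require Import structures.
From mathcomp Require Import all_boot all_algebra.
From mathcomp Require Import boolp.

Set Implicit Arguments.
Unset Strict Implicit.
Unset Printing Implicit Defensive.

Import GRing.Theory.
Local Open Scope ring_scope.
Local Open Scope quotient_scope.

(* A list [:: (m1, n1); ...; (mr, nr)] stands for the formal sum of the
   m_i ⊗ n_i; tens_eq is the congruence generated by the relations defining
   the tensor product. *)
Inductive tens_eq (k : comPzRingType) (M N : lmodType k) :
    seq (M * N) -> seq (M * N) -> Prop :=
  | tens_refl s : tens_eq s s
  | tens_sym s t : tens_eq s t -> tens_eq t s
  | tens_trans s t u : tens_eq s t -> tens_eq t u -> tens_eq s u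
  | tens_cat s s' t t' :
      tens_eq s s' -> tens_eq t t' -> tens_eq (s ++ t) (s' ++ t')
  | tens_catC s t : tens_eq (s ++ t) (t ++ s)
  | tens_0l n : tens_eq [:: (0, n)] [::]
  | tens_Dl m m' n : tens_eq [:: (m + m', n)] [:: (m, n); (m', n)]
  | tens_Dr m n n' : tens_eq [:: (m, n + n')] [:: (m, n); (m, n')]
  | tens_Z a m n : tens_eq [:: (a *: m, n)] [:: (m, a *: n)].

Section Tensor.
Variables (k : comPzRingType) (M N : lmodType k).
Implicit Types (m : M) (n : N) (s t : seq (M * N)).

Definition tens_rel : rel (seq (M * N)) := fun s t => `[< tens_eq s t >].

Lemma tens_rel_refl : reflexive tens_rel.
Proof. by move=> s; apply/asboolP; exact: tens_refl. Qed.
Lemma tens_rel_sym : symmetric tens_rel.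
Proof. by move=> s t; apply/asboolP/asboolP; exact: tens_sym. Qed.
Lemma tens_rel_trans : transitive tens_rel.
Proof.
by move=> t s u /asboolP st /asboolP tu; apply/asboolP; exact: tens_trans tu.
Qed.

Canonical tens_equiv := EquivRel tens_rel tens_rel_refl tens_rel_sym tens_rel_trans.

Definition tens : Type := {eq_quot tens_equiv}.
HB.instance Definition _ := Choice.on tens.

Definition tens_cls s : tens := \pi_{eq_quot tens_equiv} s.
Definition tens_repr (x : tens) : seq (M * N) := repr (x : {eq_quot tens_equiv}).

Lemma tens_clsP s t : reflect (tens_eq s t) (tens_cls s == tens_cls t).
Proof. by rewrite /tens_cls eqmodE; exact: asboolP. Qed.

Lemma tens_cls_eq s t : tens_eq s t -> tens_cls s = tens_cls t.
Proof. by move=> st; apply/eqP/tens_clsP. Qed.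

Lemma tens_reprK x : tens_cls (tens_repr x) = x.
Proof. exact: reprK. Qed.

Lemma tens_repr_cls s : tens_eq (tens_repr (tens_cls s)) s.
Proof. by apply/tens_clsP; rewrite tens_reprK. Qed.

Lemma tens_clsW (P : tens -> Prop) : (forall s, P (tens_cls s)) -> forall x, P x.
Proof. by move=> PP x; rewrite -(tens_reprK x). Qed.

Definition tpure m n : tens := tens_cls [:: (m, n)].

Definition tens_add (x y : tens) : tens := tens_cls (tens_repr x ++ tens_repr y).
Definition tens_oppl s : seq (M * N) := [seq (- p.1, p.2) | p <- s].
Definition tens_opp (x : tens) : tens := tens_cls (tens_oppl (tens_repr x)).

Lemma tens_add_cls s t : tens_add (tens_cls s) (tens_cls t) = tens_cls (s ++ t).
Proof. by apply: tens_cls_eq; apply: tens_cat; exact: tens_repr_cls. Qed.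

Fact tens_addA : associative tens_add.
Proof.
elim/tens_clsW=> s; elim/tens_clsW=> t; elim/tens_clsW=> u.
by rewrite !tens_add_cls catA.
Qed.
Fact tens_addC : commutative tens_add.
Proof.
elim/tens_clsW=> s; elim/tens_clsW=> t.
by rewrite !tens_add_cls; apply: tens_cls_eq; exact: tens_catC.
Qed.
Fact tens_add0 : left_id (tens_cls [::]) tens_add.
Proof. by elim/tens_clsW=> s; rewrite tens_add_cls. Qed.
Lemma tens_oppl_cls s : tens_add (tens_cls (tens_oppl s)) (tens_cls s) = tens_cls [::].
Proof.
elim: s => [|[m n] s IHs]; first by rewrite tens_add0.
rewrite -[tens_oppl _]cat1s -[_ :: s]cat1s -!tens_add_cls.
rewrite tens_addA -(tens_addA _ _ (tens_cls [:: (m, n)])).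
rewrite (tens_addC (tens_cls (tens_oppl s))) tens_addA -tens_addA.
rewrite IHs tens_addC tens_add0 tens_add_cls; apply: tens_cls_eq.
apply: tens_trans (tens_sym (tens_Dl _ _ _)) _ => /=.
by rewrite addNr; exact: tens_0l.
Qed.
Fact tens_addN : left_inverse (tens_cls [::]) tens_opp tens_add.
Proof.
by move=> x; rewrite /tens_opp -{2}(tens_reprK x); exact: tens_oppl_cls.
Qed.

HB.instance Definition _ :=
  GRing.isZmodule.Build tens tens_addA tens_addC tens_add0 tens_addN.

Lemma tens_cls_sum s : tens_cls s = \sum_(p <- s) tpure p.1 p.2.
Proof.
elim: s => [|[m n] s IHs]; first by rewrite big_nil.
by rewrite big_cons -IHs -cat1s -tens_add_cls.
Qed.

Lemma tpureDl m m' n : tpure (m + m') n = tpure m n + tpure m' n.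
Proof.
by rewrite /GRing.add /= tens_add_cls; apply: tens_cls_eq; exact: tens_Dl.
Qed.
Lemma tpureDr m n n' : tpure m (n + n') = tpure m n + tpure m n'.
Proof.
rewrite {2}/GRing.add /= tens_add_cls; apply: tens_cls_eq; exact: tens_Dr.
Qed.
Lemma tpureZ a m n : tpure (a *: m) n = tpure m (a *: n).
Proof. by apply: tens_cls_eq; exact: tens_Z. Qed.
Lemma tpure0l n : tpure 0 n = 0.
Proof. by apply: tens_cls_eq; exact: tens_0l. Qed.

Lemma tens_ind (P : tens -> Prop) :
  P 0 -> (forall m n, P (tpure m n)) -> (forall x y, P x -> P y -> P (x + y)) ->
  forall x, P x.
Proof.
move=> P0 Pp PD; elim/tens_clsW => s; rewrite tens_cls_sum.
by elim: s => [|[m n] s IHs]; rewrite ?big_nil// big_cons; apply: PD.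
Qed.

(* The map M ⊗ N -> V induced by a balanced biadditive b : M -> N -> V. *)
Record balanced (V : zmodType) (b : M -> N -> V) : Prop := Balanced {
  balancedDl : forall m m' n, b (m + m') n = b m n + b m' n;
  balancedDr : forall m n n', b m (n + n') = b m n + b m n';
  balancedZ : forall a m n, b (a *: m) n = b m (a *: n) }.

Definition tlift (V : zmodType) (b : M -> N -> V) (x : tens) : V :=
  \sum_(p <- tens_repr x) b p.1 p.2.

Section Lift.
Variables (V : zmodType) (b : M -> N -> V).
Hypothesis bP : balanced b.

Lemma balanced_eq s t :
  tens_eq s t -> \sum_(p <- s) b p.1 p.2 = \sum_(p <- t) b p.1 p.2.
Proof.
case: bP => bDl bDr bZ.
elim=> {s t} //.
- by move=> s t u _ -> _ ->.
- by move=> s s' t t' _ IHs _ IHt; rewrite !big_cat /= IHs IHt.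
- by move=> s t; rewrite !big_cat /= addrC.
- move=> n; rewrite big_seq1 big_nil /=.
  by apply: (addrI (b 0 n)); rewrite -bDl !addr0.
- by move=> m m' n; rewrite big_seq1 big_cons big_seq1 /= bDl.
- by move=> m n n'; rewrite big_seq1 big_cons big_seq1 /= bDr.
- by move=> a m n; rewrite !big_seq1 /= bZ.
Qed.

Lemma tlift_cls s : tlift b (tens_cls s) = \sum_(p <- s) b p.1 p.2.
Proof. by apply: balanced_eq; exact: tens_repr_cls. Qed.

Lemma tlift_pure m n : tlift b (tpure m n) = b m n.
Proof. by rewrite tlift_cls big_seq1. Qed.

Lemma tliftD x y : tlift b (x + y) = tlift b x + tlift b y.
Proof.
elim/tens_clsW: x => s; elim/tens_clsW: y => t.
by rewrite {1}/GRing.add /= tens_add_cls !tlift_cls big_cat.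
Qed.

Lemma tlift0 : tlift b 0 = 0.
Proof. by apply: (addrI (tlift b 0)); rewrite -tliftD !addr0. Qed.
End Lift.

End Tensor.

Arguments tpure {k M N} m n.
Arguments tlift {k M N V} b x.

Lemma additive_at0 (U V : zmodType) (f : U -> V) :
  (forall x y, f (x + y) = f x + f y) -> f 0 = 0.
Proof. by move=> fD; apply: (addrI (f 0)); rewrite -fD !addr0. Qed.

Lemma tens_ext (k : comPzRingType) (M N : lmodType k) (V : zmodType)
    (f g : tens M N -> V) :
  (forall x y, f (x + y) = f x + f y) -> (forall x y, g (x + y) = g x + g y) ->
  (forall m n, f (tpure m n) = g (tpure m n)) -> f =1 g.
Proof.
move=> fD gD fg; elim/tens_ind => [|//|x y IHx IHy]; last by rewrite fD gD IHx IHy.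
by rewrite !additive_at0.
Qed.

Section Lift2.
Variables (k k' : comPzRingType) (M N : lmodType k) (M' N' : lmodType k').
Variables (V : zmodType) (b : M -> N -> M' -> N' -> V).

Definition tlift2 (x : tens M N) (y : tens M' N') : V :=
  tlift (fun m n => tlift (b m n) y) x.

Hypothesis bP1 : forall m' n', balanced (fun m n => b m n m' n').
Hypothesis bP2 : forall m n, balanced (b m n).

Let bP y : balanced (fun m n => tlift (b m n) y).
Proof.
split=> [m m' n|m n n'|a m n]; elim/tens_clsW: y => s; rewrite !tlift_cls //.
- by rewrite -big_split; apply: eq_bigr => p _; rewrite (balancedDl (bP1 _ _)).
- by rewrite -big_split; apply: eq_bigr => p _; rewrite (balancedDr (bP1 _ _)).
- by apply: eq_bigr => p _; rewrite (balancedZ (bP1 _ _)).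
Qed.

Lemma tlift2_pure m n m' n' : tlift2 (tpure m n) (tpure m' n') = b m n m' n'.
Proof. by rewrite /tlift2 tlift_pure // tlift_pure. Qed.

Lemma tlift2Dl x x' y : tlift2 (x + x') y = tlift2 x y + tlift2 x' y.
Proof. by rewrite /tlift2 tliftD. Qed.

Lemma tlift2Dr x y y' : tlift2 x (y + y') = tlift2 x y + tlift2 x y'.
Proof.
rewrite /tlift2; elim/tens_clsW: x => s; rewrite !tlift_cls //.
by rewrite -big_split; apply: eq_bigr => p _; rewrite tliftD.
Qed.

Lemma tlift20l y : tlift2 0 y = 0.
Proof. by apply: (@additive_at0 _ _ (tlift2^~ y)) => *; exact: tlift2Dl. Qed.
Lemma tlift20r x : tlift2 x 0 = 0.
Proof. by apply: additive_at0 => *; exact: tlift2Dr. Qed.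
End Lift2.

(* The library's comAlgType excludes the zero ring and attaches a single scalar
   structure to a ring; here the zero algebra is a legitimate test object for
   functors of points, and one ring is used as an algebra over several bases. *)
Record alg (k : comPzRingType) := Alg {
  alg_ring :> comPzRingType;
  alg_map : {rmorphism k -> alg_ring} }.
Arguments alg_map {k} A : rename.

Record ahom (k : comPzRingType) (A B : alg k) := AHom {
  ahom_fun :> {rmorphism A -> B};
  ahomK : forall c, ahom_fun (alg_map A c) = alg_map B c }.
Arguments ahom {k} A B.

(* restriction of scalars *)
Definition res (k k' : comPzRingType) (p : {rmorphism k -> k'}) (A : alg k') :
  alg k := Alg (alg_map A \o p).

Section AlgHoms.
Variables (k : comPzRingType).

Definition ahom_id (A : alg k) : ahom A A :=
  @AHom _ A A (idfun : {rmorphism A -> A}) (fun=> erefl).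

Fact ahom_compK (A B C : alg k) (g : ahom B C) (f : ahom A B) c :
  (g \o f) (alg_map A c) = alg_map C c.
Proof. by rewrite /= !ahomK. Qed.
Definition ahom_comp (A B C : alg k) (g : ahom B C) (f : ahom A B) : ahom A C :=
  AHom (@ahom_compK A B C g f).

Definition base_alg : alg k := Alg (idfun : {rmorphism k -> k}).
Definition ahom_unit (A : alg k) : ahom base_alg A :=
  @AHom _ base_alg A (alg_map A) (fun=> erefl).

Fact ahom_resK (k' : comPzRingType) (p : {rmorphism k -> k'}) (A B : alg k')
  (f : ahom A B) c : f (alg_map (res p A) c) = alg_map (res p B) c.
Proof. by rewrite /= ahomK. Qed.
Definition ahom_res (k' : comPzRingType) (p : {rmorphism k -> k'}) (A B : alg k')
    (f : ahom A B) : ahom (res p A) (res p B) :=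
  @AHom _ (res p A) (res p B) f (@ahom_resK _ p A B f).
End AlgHoms.

(* an algebra as a module over its base *)
Definition amod (k : comPzRingType) (A : alg k) : Type := A.
Section AMod.
Variables (k : comPzRingType) (A : alg k).
HB.instance Definition _ := GRing.Zmodule.on (amod A).
Definition amod_scale (c : k) (x : amod A) : amod A := alg_map A c * (x : A).
Fact amod_scaleA a b x : amod_scale a (amod_scale b x) = amod_scale (a * b) x.
Proof. by rewrite /amod_scale rmorphM mulrA. Qed.
Fact amod_scale1 : left_id 1 amod_scale.
Proof. by move=> x; rewrite /amod_scale rmorph1 mul1r. Qed.
Fact amod_scaleDr : right_distributive amod_scale +%R.
Proof. by move=> a x y; rewrite /amod_scale mulrDr. Qed.
Fact amod_scaleDl x : {morph amod_scale^~ x : a b / a + b}.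
Proof. by move=> a b; rewrite /amod_scale rmorphD mulrDl. Qed.
HB.instance Definition _ := GRing.Zmodule_isLmodule.Build k (amod A)
  amod_scaleA amod_scale1 amod_scaleDr amod_scaleDl.
Lemma amodZE c (x : amod A) : c *: x = alg_map A c * (x : A) :> A.
Proof. by []. Qed.
End AMod.

(* The A-module A ⊗_k M. *)
Definition bc (k : comPzRingType) (A : alg k) (M : lmodType k) : Type :=
  tens (amod A) M.
Section BaseChange.
Variables (k : comPzRingType) (A : alg k) (M : lmodType k).
HB.instance Definition _ := GRing.Zmodule.on (bc A M).

Definition bpure (a : A) (m : M) : bc A M := tpure (a : amod A) m.
Definition bc_scale (a : A) (x : bc A M) : bc A M :=
  tlift (fun (b : amod A) (m : M) => bpure (a * (b : A)) m) x.

Fact bc_scaleP (a : A) :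
  balanced (fun (b : amod A) (m : M) => bpure (a * (b : A)) m).
Proof.
split=> [x x' m|x m m'|c x m]; rewrite /bpure.
- by rewrite -tpureDl -mulrDr.
- by rewrite tpureDr.
- by rewrite -tpureZ !amodZE mulrCA.
Qed.

Lemma bc_scale_pure a b m : bc_scale a (bpure b m) = bpure (a * b) m.
Proof. by rewrite /bc_scale tlift_pure //; exact: bc_scaleP. Qed.
Lemma bc_scaleDr : right_distributive bc_scale +%R.
Proof. by move=> a x y; apply: tliftD; exact: bc_scaleP. Qed.
Fact bc_scaleA a b x : bc_scale a (bc_scale b x) = bc_scale (a * b) x.
Proof.
move: x; apply: tens_ext => [x y|x y|c m]; rewrite ?bc_scaleDr //.
by rewrite !bc_scale_pure mulrA.
Qed.
Fact bc_scale1 : left_id 1 bc_scale.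
Proof.
by apply: tens_ext => [x y|//|c m]; rewrite ?bc_scaleDr // bc_scale_pure mul1r.
Qed.
Fact bc_scaleDl x : {morph bc_scale^~ x : a b / a + b}.
Proof.
move=> a b /=; move: x.
apply: tens_ext => [x y|x y|c m]; rewrite ?bc_scaleDr //; first by rewrite addrACA.
by rewrite !bc_scale_pure mulrDl; exact: tpureDl.
Qed.
HB.instance Definition _ := GRing.Zmodule_isLmodule.Build A (bc A M)
  bc_scaleA bc_scale1 bc_scaleDr bc_scaleDl.
Lemma bcZ_pure (a b : A) m : a *: bpure b m = bpure (a * b) m.
Proof. exact: bc_scale_pure. Qed.
End BaseChange.
Arguments bpure {k A M} a m.

(* f ⊗ id : A ⊗ M -> B ⊗ M *)
Definition bc_map (k : comPzRingType) (A B : alg k) (f : ahom A B)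
    (M : lmodType k) (x : bc A M) : bc B M :=
  tlift (fun (a : amod A) (m : M) => bpure (f (a : A)) m) x.
(* id ⊗ f : A ⊗ M -> A ⊗ N *)
Definition bc_fmap (k : comPzRingType) (A : alg k) (M N : lmodType k)
    (f : {linear M -> N}) (x : bc A M) : bc A N :=
  tlift (fun (a : amod A) (m : M) => bpure (a : A) (f m)) x.
Arguments bc_fmap {k} A {M N} f x.

Section BcMap.
Variables (k : comPzRingType) (A B : alg k) (f : ahom A B) (M N : lmodType k).
Fact bc_mapP : balanced (fun (a : amod A) (m : M) => bpure (f (a : A)) m).
Proof.
split=> [x x' m|x m m'|c x m]; rewrite /bpure.
- by rewrite rmorphD; exact: tpureDl.
- by rewrite tpureDr.
- by rewrite -tpureZ !amodZE rmorphM ahomK.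
Qed.
Lemma bc_map_pure a (m : M) : bc_map f (bpure a m) = bpure (f a) m.
Proof. by rewrite /bc_map tlift_pure //; exact: bc_mapP. Qed.
Lemma bc_mapD (x y : bc A M) : bc_map f (x + y) = bc_map f x + bc_map f y.
Proof. by apply: tliftD; exact: bc_mapP. Qed.
Lemma bc_mapZ a (x : bc A M) : bc_map f (a *: x) = f a *: bc_map f x.
Proof.
move: x; apply: tens_ext => [x y|x y|c m]; rewrite ?scalerDr ?bc_mapD ?scalerDr //.
by rewrite !(bcZ_pure, bc_map_pure) rmorphM.
Qed.
Variable g : {linear M -> N}.
Fact bc_fmapP : balanced (fun (a : amod A) (m : M) => bpure (a : A) (g m)).
Proof.
split=> [x x' m|x m m'|c x m]; rewrite /bpure.
- by rewrite tpureDl.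
- by rewrite raddfD tpureDr.
- by rewrite linearZ tpureZ.
Qed.
Lemma bc_fmap_pure (a : A) (m : M) : bc_fmap A g (bpure a m) = bpure a (g m).
Proof. by rewrite /bc_fmap tlift_pure //; exact: bc_fmapP. Qed.
End BcMap.

Definition atens_ring (k : comPzRingType) (A B : alg k) : Type :=
  tens (amod A) (amod B).
Section AlgTensor.
Variables (k : comPzRingType) (A B : alg k).
HB.instance Definition _ := GRing.Zmodule.on (atens_ring A B).

Definition apure (a : A) (b : B) : atens_ring A B :=
  tpure (a : amod A) (b : amod B).

Definition apure_mul (a : amod A) (b : amod B) (a' : amod A) (b' : amod B) :
  atens_ring A B := apure ((a : A) * (a' : A)) ((b : B) * (b' : B)).
Definition atens_mul : atens_ring A B -> atens_ring A B -> atens_ring A B :=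
  tlift2 apure_mul.

Lemma apureDl a a' b : apure (a + a') b = apure a b + apure a' b.
Proof. exact: tpureDl. Qed.
Lemma apureDr a b b' : apure a (b + b') = apure a b + apure a b'.
Proof. exact: tpureDr. Qed.
Lemma apureZ c a b : apure (alg_map A c * a) b = apure a (alg_map B c * b).
Proof. exact: (@tpureZ k (amod A) (amod B)). Qed.

Fact apure_mulP1 a' b' : balanced (fun a b => apure_mul a b a' b').
Proof.
rewrite /apure_mul; split=> [x x' m|x m m'|c x m].
- by rewrite mulrDl apureDl.
- by rewrite mulrDl apureDr.
- by rewrite !amodZE -!mulrA apureZ.
Qed.
Fact apure_mulP2 a b : balanced (apure_mul a b).
Proof.
rewrite /apure_mul; split=> [x x' m|x m m'|c x m].
- by rewrite mulrDr apureDl.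
- by rewrite mulrDr apureDr.
- by rewrite !amodZE ![_ * (alg_map _ _ * _)]mulrCA apureZ.
Qed.

Lemma atens_mul_pure a b a' b' :
  atens_mul (apure a b) (apure a' b') = apure (a * a') (b * b').
Proof. exact: (tlift2_pure apure_mulP1 apure_mulP2). Qed.
Lemma atens_mulDl : left_distributive atens_mul +%R.
Proof. by move=> x y z; exact: (tlift2Dl apure_mulP1 apure_mulP2). Qed.
Lemma atens_mulDr : right_distributive atens_mul +%R.
Proof.
by move=> x y z; exact: (tlift2Dr apure_mulP1 apure_mulP2).
Qed.
Fact atens_mulA : associative atens_mul.
Proof.
move=> x y z; move: x; apply: tens_ext => [x x'|x x'|a b]; rewrite ?atens_mulDl //.
move: y; apply: tens_ext => [y y'|y y'|a' b'].
- by rewrite atens_mulDl atens_mulDr.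
- by rewrite atens_mulDr atens_mulDl.
move: z; apply: tens_ext => [z z'|z z'|a2 b2].
- by rewrite !atens_mulDr.
- by rewrite !atens_mulDr.
by rewrite -!/(apure _ _) !atens_mul_pure !mulrA.
Qed.
Fact atens_mulC : commutative atens_mul.
Proof.
move=> x y; move: x; apply: tens_ext => [x x'|x x'|a b].
- by rewrite atens_mulDl.
- by rewrite atens_mulDr.
move: y; apply: tens_ext => [y y'|y y'|a' b'].
- by rewrite atens_mulDr.
- by rewrite atens_mulDl.
by rewrite -!/(apure _ _) !atens_mul_pure mulrC [b * _]mulrC.
Qed.
Fact atens_mul1 : left_id (apure 1 1) atens_mul.
Proof.
apply: tens_ext => [x y|//|a b]; first by rewrite atens_mulDr.
by rewrite -!/(apure _ _) atens_mul_pure !mul1r.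
Qed.
HB.instance Definition _ := GRing.Zmodule_isComPzRing.Build (atens_ring A B)
  atens_mulA atens_mulC atens_mul1 atens_mulDl.

Lemma apureM a b a' b' : apure a b * apure a' b' = apure (a * a') (b * b').
Proof. exact: atens_mul_pure. Qed.

Definition in1_fun (a : A) : atens_ring A B := apure a 1.
Fact in1_additive : zmod_morphism in1_fun.
Proof.
move=> a a'; apply: (addIr (in1_fun a')).
by rewrite subrK /in1_fun -apureDl subrK.
Qed.
Fact in1_mult : monoid_morphism in1_fun.
Proof. by split=> // a a'; rewrite /in1_fun apureM mulr1. Qed.
HB.instance Definition _ := GRing.isZmodMorphism.Build _ _ in1_fun in1_additive.
HB.instance Definition _ := GRing.isMonoidMorphism.Build _ _ in1_fun in1_mult.

Definition in2_fun (b : B) : atens_ring A B := apure 1 b.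
Fact in2_additive : zmod_morphism in2_fun.
Proof.
move=> a a'; apply: (addIr (in2_fun a')).
by rewrite subrK /in2_fun -apureDr subrK.
Qed.
Fact in2_mult : monoid_morphism in2_fun.
Proof. by split=> // a a'; rewrite /in2_fun apureM mulr1. Qed.
HB.instance Definition _ := GRing.isZmodMorphism.Build _ _ in2_fun in2_additive.
HB.instance Definition _ := GRing.isMonoidMorphism.Build _ _ in2_fun in2_mult.

Definition atens : alg k := @Alg k (atens_ring A B) (in1_fun \o alg_map A).

Definition in1 : ahom A atens := @AHom _ A atens in1_fun (fun=> erefl).

Fact in2K c : in2_fun (alg_map B c) = alg_map atens c.
Proof.
by rewrite /= /in1_fun -[alg_map A c]mulr1 apureZ mulr1.
Qed.
Definition in2 : ahom B atens := @AHom _ B atens in2_fun in2K.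

Lemma apureE a b : apure a b = in1 a * in2 b.
Proof. by rewrite /= /in1_fun /in2_fun apureM mulr1 mul1r. Qed.

Section Copair.
Variables (C : alg k) (f : ahom A C) (g : ahom B C).

Definition copair_fun (x : atens_ring A B) : C :=
  tlift (fun (a : amod A) (b : amod B) => f (a : A) * g (b : B)) x.

Fact copairP : balanced (fun (a : amod A) (b : amod B) => f (a : A) * g (b : B)).
Proof.
split=> [x x' m|x m m'|c x m].
- by rewrite rmorphD mulrDl.
- by rewrite rmorphD mulrDr.
- by rewrite !amodZE !rmorphM !ahomK mulrCA mulrA.
Qed.
Lemma copair_pure a b : copair_fun (apure a b) = f a * g b.
Proof. by rewrite /copair_fun tlift_pure //; exact: copairP. Qed.
Fact copair_additive : zmod_morphism copair_fun.
Proof.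
move=> x y; apply: (addIr (copair_fun y)).
by rewrite subrK -tliftD ?subrK //; exact: copairP.
Qed.
HB.instance Definition _ :=
  GRing.isZmodMorphism.Build _ _ copair_fun copair_additive.
Fact copair_mult : monoid_morphism copair_fun.
Proof.
split=> [|x y]; first by rewrite copair_pure !rmorph1 mulr1.
move: x; apply: tens_ext => [x x'|x x'|a b].
- by rewrite mulrDl raddfD.
- by rewrite raddfD mulrDl.
move: y; apply: tens_ext => [y y'|y y'|a' b'].
- by rewrite mulrDr raddfD.
- by rewrite raddfD mulrDr.
by rewrite -!/(apure _ _) apureM !copair_pure !rmorphM mulrACA.
Qed.
HB.instance Definition _ :=
  GRing.isMonoidMorphism.Build _ _ copair_fun copair_mult.
Fact copairK c : copair_fun (alg_map atens c) = alg_map C c.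
Proof. by rewrite copair_pure rmorph1 mulr1 ahomK. Qed.
Definition copair : ahom atens C := @AHom _ atens C copair_fun copairK.
End Copair.

Lemma copair_in1 (C : alg k) (f : ahom A C) (g : ahom B C) a :
  copair f g (in1 a) = f a.
Proof. by rewrite /= copair_pure rmorph1 mulr1. Qed.
Lemma copair_in2 (C : alg k) (f : ahom A C) (g : ahom B C) b :
  copair f g (in2 b) = g b.
Proof. by rewrite /= copair_pure rmorph1 mul1r. Qed.

Lemma atens_ext (C : pzRingType) (f g : {rmorphism atens_ring A B -> C}) :
  (forall a, f (in1 a) = g (in1 a)) -> (forall b, f (in2 b) = g (in2 b)) ->
  f =1 g.
Proof.
move=> fg1 fg2; apply: tens_ext => [x y|x y|a b]; rewrite ?raddfD //.
by rewrite -/(apure _ _) apureE !rmorphM fg1 fg2.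
Qed.
End AlgTensor.
Arguments apure {k A B} a b.
Arguments in1 {k} A B.
Arguments in2 {k} A B.
Arguments copair {k A B C} f g.

(* f ⊗ g : A ⊗ B -> A' ⊗ B' *)
Definition atens_map (k : comPzRingType) (A A' B B' : alg k)
    (f : ahom A A') (g : ahom B B') : ahom (atens A B) (atens A' B') :=
  copair (ahom_comp (in1 A' B') f) (ahom_comp (in2 A' B') g).

(* cga_mul i j n x y is the component of degree n of the product of x and y,
   homogeneous of degrees i and j: indexing by n avoids transports along
   equalities of degrees, and cga_mul_deg says that it vanishes unless
   n = i + j. The last field is the condition B_0 = S. *)
Record cga (S : comPzRingType) := Cga {
  cga_comp :> nat -> lmodType S;
  cga_mul : forall i j n, cga_comp i -> cga_comp j -> cga_comp n;
  cga_one : cga_comp 0%N;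
  cga_mul_deg : forall i j n (x : cga_comp i) (y : cga_comp j),
    n <> (i + j)%N -> cga_mul n x y = 0;
  cga_mulDl : forall i j n (x x' : cga_comp i) (y : cga_comp j),
    cga_mul n (x + x') y = cga_mul n x y + cga_mul n x' y;
  cga_mulZl : forall i j n a (x : cga_comp i) (y : cga_comp j),
    cga_mul n (a *: x) y = a *: cga_mul n x y;
  cga_mulC : forall i j n (x : cga_comp i) (y : cga_comp j),
    cga_mul n x y = cga_mul n y x;
  cga_mulA : forall i j l n (x : cga_comp i) (y : cga_comp j) (z : cga_comp l),
    cga_mul n x (cga_mul (j + l)%N y z) = cga_mul n (cga_mul (i + j)%N x y) z;
  cga_mul1 : forall n (x : cga_comp n), cga_mul n cga_one x = x;
  cga_deg0 : bijective (fun s : S => s *: cga_one) }.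
Arguments cga_mul {S B i j} n x y : rename.
Arguments cga_one {S} B : rename.

(* The ring B = \prod_n B_n. *)
Definition cring (S : comPzRingType) (B : cga S) : Type := forall n, B n.

Section CRing.
Variables (S : comPzRingType) (B : cga S).
Implicit Types a b c : cring B.

HB.instance Definition _ := Choice.copy (cring B) (forall n, B n).

Lemma cring_ext a b : (forall n, a n = b n) -> a = b.
Proof. exact: functional_extensionality_dep. Qed.

Definition cring_add a b : cring B := fun n => a n + b n.
Definition cring_opp a : cring B := fun n => - a n.
Definition cring_zero : cring B := fun n => 0.
Fact cring_addA : associative cring_add.
Proof. by move=> a b c; apply: cring_ext => n; exact: addrA. Qed.
Fact cring_addC : commutative cring_add.
Proof. by move=> a b; apply: cring_ext => n; exact: addrC. Qed.
Fact cring_add0 : left_id cring_zero cring_add.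
Proof. by move=> a; apply: cring_ext => n; exact: add0r. Qed.
Fact cring_addN : left_inverse cring_zero cring_opp cring_add.
Proof. by move=> a; apply: cring_ext => n; exact: addNr. Qed.
HB.instance Definition _ :=
  GRing.isZmodule.Build (cring B) cring_addA cring_addC cring_add0 cring_addN.

Lemma cringDE a b n : (a + b) n = a n + b n. Proof. by []. Qed.
Lemma cring0E n : (0 : cring B) n = 0. Proof. by []. Qed.

(* the homogeneous element x of degree m *)
Definition homg m (x : B m) : cring B := fun n =>
  if m =P n is ReflectT e then ecast n (B n) e x else 0.

Lemma homg_id m (x : B m) : homg x m = x.
Proof. by rewrite /homg; case: eqP => // e; rewrite (eq_axiomK e). Qed.
Lemma homg_neq m (x : B m) n : m <> n -> homg x n = 0.
Proof. by rewrite /homg; case: eqP. Qed.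
Lemma homgD m (x y : B m) : homg (x + y) = homg x + homg y.
Proof.
apply: cring_ext => n; rewrite cringDE.
have [e|e] := eqVneq m n; first by subst n; rewrite !homg_id.
by move/eqP: e => e; rewrite !homg_neq // addr0.
Qed.

Lemma cga_mul0l i j n (y : B j) : cga_mul n (0 : B i) y = 0.
Proof. by apply: (@additive_at0 _ _ (fun x : B i => cga_mul n x y)) => *; exact: cga_mulDl. Qed.
Lemma cga_mulDr i j n (x : B i) (y y' : B j) :
  cga_mul n x (y + y') = cga_mul n x y + cga_mul n x y'.
Proof. by rewrite cga_mulC cga_mulDl !(cga_mulC n x). Qed.
Lemma cga_mulZr i j n (s : S) (x : B i) (y : B j) :
  cga_mul n x (s *: y) = s *: cga_mul n x y.
Proof. by rewrite cga_mulC cga_mulZl cga_mulC. Qed.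
Lemma cga_mul0r i j n (x : B i) : cga_mul n x (0 : B j) = 0.
Proof. by rewrite cga_mulC cga_mul0l. Qed.
Lemma cga_mul_suml I (r : seq I) (P : pred I) i j n (F : I -> B i) (y : B j) :
  cga_mul n (\sum_(l <- r | P l) F l) y = \sum_(l <- r | P l) cga_mul n (F l) y.
Proof.
by apply: (big_morph (fun x : B i => cga_mul n x y)) => [x x'|];
  [exact: cga_mulDl|exact: cga_mul0l].
Qed.
Lemma cga_mul_sumr I (r : seq I) (P : pred I) i j n (F : I -> B j) (x : B i) :
  cga_mul n x (\sum_(l <- r | P l) F l) = \sum_(l <- r | P l) cga_mul n x (F l).
Proof.
by apply: (big_morph (fun y : B j => cga_mul n x y)) => [y y'|];
  [exact: cga_mulDr|exact: cga_mul0r].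
Qed.

Definition cring_mul a b : cring B := fun n =>
  \sum_(i < n.+1) cga_mul n (a i) (b (n - i)%N).

Lemma cring_mulE N a b n : (n < N)%N ->
  cring_mul a b n = \sum_(i < N) \sum_(j < N) cga_mul n (a i) (b j).
Proof.
move=> ltnN; rewrite /cring_mul.
rewrite (big_ord_widen N (fun i => cga_mul n (a i) (b (n - i)%N))) //.
rewrite big_mkcond; apply: eq_bigr => i _; case: ltnP => lein.
  have lt : (n - i < N)%N by apply: leq_ltn_trans ltnN; exact: leq_subr.
  rewrite (bigD1 (Ordinal lt)) //= big1 ?addr0 // => j /eqP neq.
  apply: cga_mul_deg => e; apply: neq; apply: val_inj => /=.
  by rewrite e addKn.
rewrite big1 // => j _; apply: cga_mul_deg => e.
by move: lein; rewrite e -{2}[nat_of_ord i]addn0 -addnS leq_add2l.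
Qed.

Fact cring_mulC : commutative cring_mul.
Proof.
move=> a b; apply: cring_ext => n; rewrite !(cring_mulE _ _ (ltnSn n)).
by rewrite exchange_big; do 2!apply: eq_bigr => ? _; exact: cga_mulC.
Qed.
Fact cring_mulDl : left_distributive cring_mul +%R.
Proof.
move=> a b c; apply: cring_ext => n; rewrite cringDE /cring_mul -big_split.
by apply: eq_bigr => i _; exact: cga_mulDl.
Qed.
Lemma cring_mul3l a b c n : cring_mul (cring_mul a b) c n =
  \sum_(i < n.+1) \sum_(j < n.+1) \sum_(l < n.+1)
     cga_mul n (cga_mul (i + j)%N (a i) (b j)) (c l).
Proof.
rewrite (cring_mulE _ _ (ltnSn n)).
under eq_bigr => p _ do under eq_bigr => l _ do
  rewrite (cring_mulE _ _ (ltn_ord p)) cga_mul_suml.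
under eq_bigr => p _ do (rewrite exchange_big; under eq_bigr => i _ do
   under eq_bigr => l _ do rewrite cga_mul_suml).
rewrite exchange_big; apply: eq_bigr => i _.
under eq_bigr => p _ do rewrite exchange_big.
rewrite exchange_big; apply: eq_bigr => j _.
rewrite exchange_big; apply: eq_bigr => l _.
have [lt|ge] := ltnP (i + j) n.+1.
  rewrite (bigD1 (Ordinal lt)) //= big1 ?addr0 // => p /eqP neq.
  rewrite (cga_mul_deg (n := p)) ?cga_mul0l // => e.
  by apply: neq; apply: val_inj.
rewrite big1 => [|p _]; first by rewrite cga_mul_deg // => e; move: ge;
  rewrite {1}e ltnNge leq_addr.
rewrite (cga_mul_deg (n := p)) ?cga_mul0l // => e.
by move: ge; rewrite -e leqNgt ltn_ord.
Qed.
Fact cring_mulA : associative cring_mul.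
Proof.
move=> a b c; rewrite [cring_mul b c]cring_mulC cring_mulC.
apply: cring_ext => n; rewrite !cring_mul3l exchange_big.
under eq_bigr => j _ do rewrite exchange_big.
rewrite exchange_big; apply: eq_bigr => i _; apply: eq_bigr => j _.
apply: eq_bigr => l _; rewrite -cga_mulA cga_mulC.
by rewrite (cga_mulC (j + i) (b j)) (addnC j).
Qed.
Fact cring_mul1 : left_id (homg (cga_one B)) cring_mul.
Proof.
move=> a; apply: cring_ext => n.
rewrite /cring_mul big_ord_recl big1 => [|i _]; last by rewrite homg_neq // cga_mul0l.
by rewrite addr0 homg_id /= subn0 cga_mul1.
Qed.
HB.instance Definition _ := GRing.Zmodule_isComPzRing.Build (cring B)
  cring_mulA cring_mulC cring_mul1 cring_mulDl.

Lemma cringME a b n :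
  (a * b) n = \sum_(i < n.+1) cga_mul n (a i) (b (n - i)%N).
Proof. by []. Qed.

Definition cring_cst (s : S) : cring B := homg (s *: cga_one B).
Fact cring_cst_additive : zmod_morphism cring_cst.
Proof.
move=> s t; apply: (addIr (cring_cst t)).
by rewrite subrK /cring_cst -homgD -scalerDl subrK.
Qed.
Lemma cring_cstM s b n : (cring_cst s * b) n = s *: b n.
Proof.
rewrite cringME big_ord_recl big1 => [|i _]; last first.
  by rewrite [cring_cst s _]homg_neq // cga_mul0l.
by rewrite addr0 /cring_cst homg_id /= subn0 cga_mulZl cga_mul1.
Qed.
Fact cring_cst_mult : monoid_morphism cring_cst.
Proof.
split=> [|s t]; first by rewrite /cring_cst scale1r.
apply: cring_ext => n; rewrite cring_cstM /cring_cst.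
have [e|e] := eqVneq 0%N n; first by subst n; rewrite !homg_id scalerA.
by move/eqP: e => e; rewrite !homg_neq // scaler0.
Qed.
HB.instance Definition _ :=
  GRing.isZmodMorphism.Build _ _ cring_cst cring_cst_additive.
HB.instance Definition _ :=
  GRing.isMonoidMorphism.Build _ _ cring_cst cring_cst_mult.

Definition calg : alg S := @Alg S (cring B) cring_cst.

(* g^(i), the part of g raising degrees by i *)
Definition part (g : cring B -> cring B) (i : nat) : cring B -> cring B :=
  fun b n => if (i <= n)%N then g (homg (b (n - i)%N)) n else 0.

Definition positive (g : cring B -> cring B) : Prop :=
  forall j (x : B j) n, (n < j)%N -> g (homg x) n = 0.

(* continuity of an additive map, for the filtration by the \prod_(i >= m) B_i *)
Definition cring_continuous (g : cring B -> cring B) : Prop :=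
  forall m, exists p, forall b,
    (forall n, (n < p)%N -> b n = 0) -> forall n, (n < m)%N -> g b n = 0.
End CRing.
Arguments cring_cst {S} B s.

(* The graded S-subalgebra of \bigoplus_n B_n generated by the homogeneous
   elements satisfying X is everything. *)
Definition graded_generated (S : comPzRingType) (B : cga S)
    (X : forall n, B n -> Prop) : Prop :=
  forall P : forall n, B n -> Prop,
    (forall n x, X n x -> P n x) ->
    P 0%N (cga_one B) ->
    (forall n (x y : B n), P n x -> P n y -> P n (x + y)) ->
    (forall n (s : S) (x : B n), P n x -> P n (s *: x)) ->
    (forall i j (x : B i) (y : B j), P i x -> P j y ->
       P (i + j)%N (cga_mul (i + j)%N x y)) ->
  forall n x, P n x.

(* The S'-cga S' ⊗ B. *)
Section BcCga.
Variables (S : comPzRingType) (A : alg S) (B : cga S).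

Let T n : lmodType A := bc A (B n).

Definition bc_cga_pmul i j n (a : amod A) (x : B i) (a' : amod A) (y : B j) : T n :=
  bpure ((a : A) * (a' : A)) (cga_mul n x y).
Definition bc_cga_mul i j n : T i -> T j -> T n := tlift2 (@bc_cga_pmul i j n).

Fact bc_cga_pmulP1 i j n (a' : amod A) (y : B j) :
  balanced (fun a (x : B i) => bc_cga_pmul n a x a' y).
Proof.
rewrite /bc_cga_pmul /bpure; split=> [a b x|a x x'|c a x].
- by rewrite mulrDl; exact: tpureDl.
- by rewrite cga_mulDl; exact: tpureDr.
- by rewrite cga_mulZl amodZE -mulrA -tpureZ.
Qed.
Fact bc_cga_pmulP2 i j n (a : amod A) (x : B i) :
  balanced (@bc_cga_pmul i j n a x).
Proof.
rewrite /bc_cga_pmul /bpure; split=> [a' b y|a' y y'|c a' y].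
- by rewrite mulrDr; exact: tpureDl.
- by rewrite cga_mulDr; exact: tpureDr.
- by rewrite cga_mulZr amodZE mulrCA -tpureZ.
Qed.
Lemma bc_cga_mul_pure i j n a (x : B i) a' (y : B j) :
  bc_cga_mul n (bpure a x) (bpure a' y) = bpure (a * a') (cga_mul n x y).
Proof. exact: (tlift2_pure (@bc_cga_pmulP1 i j n) (@bc_cga_pmulP2 i j n)). Qed.
Fact bc_cga_mulDl i j n (x x' : T i) (y : T j) :
  bc_cga_mul n (x + x') y = bc_cga_mul n x y + bc_cga_mul n x' y.
Proof. exact: (tlift2Dl (@bc_cga_pmulP1 i j n) (@bc_cga_pmulP2 i j n)). Qed.
Lemma bc_cga_mulDr i j n (x : T i) (y y' : T j) :
  bc_cga_mul n x (y + y') = bc_cga_mul n x y + bc_cga_mul n x y'.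
Proof. exact: (tlift2Dr (@bc_cga_pmulP1 i j n) (@bc_cga_pmulP2 i j n)). Qed.

Lemma bpure0r n (a : A) : bpure a (0 : B n) = 0 :> T n.
Proof. by apply: (@additive_at0 _ (T n) (bpure a)) => *; exact: tpureDr. Qed.

Fact bc_cga_mul_deg i j n (x : T i) (y : T j) :
  n <> (i + j)%N -> bc_cga_mul n x y = 0.
Proof.
move=> neq; move: x; apply: (tens_ext (g := fun=> 0)) => [x x'|x x'|a x].
- exact: bc_cga_mulDl.
- by rewrite addr0.
move: y; apply: (tens_ext (g := fun=> 0)) => [y y'|y y'|a' y].
- exact: bc_cga_mulDr.
- by rewrite addr0.
by rewrite -!/(bpure _ _) bc_cga_mul_pure cga_mul_deg // bpure0r.
Qed.
Fact bc_cga_mulZl i j n a (x : T i) (y : T j) :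
  bc_cga_mul n (a *: x) y = a *: bc_cga_mul n x y.
Proof.
move: x; apply: tens_ext => [x x'|x x'|b x].
- by rewrite scalerDr bc_cga_mulDl.
- by rewrite bc_cga_mulDl scalerDr.
move: y; apply: tens_ext => [y y'|y y'|a' y].
- exact: bc_cga_mulDr.
- by rewrite bc_cga_mulDr scalerDr.
by rewrite -!/(bpure _ _) !(bcZ_pure, bc_cga_mul_pure) mulrA.
Qed.
Fact bc_cga_mulC i j n (x : T i) (y : T j) :
  bc_cga_mul n x y = bc_cga_mul n y x.
Proof.
move: x; apply: tens_ext => [x x'|x x'|b x].
- exact: bc_cga_mulDl.
- exact: bc_cga_mulDr.
move: y; apply: tens_ext => [y y'|y y'|a' y].
- exact: bc_cga_mulDr.
- exact: bc_cga_mulDl.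
by rewrite -!/(bpure _ _) !bc_cga_mul_pure mulrC cga_mulC.
Qed.
Fact bc_cga_mulA i j l n (x : T i) (y : T j) (z : T l) :
  bc_cga_mul n x (bc_cga_mul (j + l)%N y z) =
  bc_cga_mul n (bc_cga_mul (i + j)%N x y) z.
Proof.
move: x; apply: tens_ext => [x x'|x x'|a x]; rewrite ?bc_cga_mulDl //.
move: y; apply: tens_ext => [y y'|y y'|b y].
- by rewrite bc_cga_mulDl bc_cga_mulDr.
- by rewrite bc_cga_mulDr bc_cga_mulDl.
move: z; apply: tens_ext => [z z'|z z'|c z]; rewrite ?bc_cga_mulDr //.
by rewrite -!/(bpure _ _) !bc_cga_mul_pure mulrA cga_mulA.
Qed.
Definition bc_cga_one : T 0%N := bpure 1 (cga_one B).
Fact bc_cga_mul1 n (x : T n) : bc_cga_mul n bc_cga_one x = x.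
Proof.
move: x; apply: tens_ext => [x x'|//|a x]; first exact: bc_cga_mulDr.
by rewrite -!/(bpure _ _) bc_cga_mul_pure mul1r cga_mul1.
Qed.
Fact bc_cga_deg0 : bijective (fun a : A => a *: bc_cga_one).
Proof.
have [h hK Kh] := cga_deg0 B.
have hD x y : h (x + y) = h x + h y.
  by apply: (can_inj hK); rewrite scalerDl !Kh.
have hZ c x : h (c *: x) = c * h x.
  by apply: (can_inj hK); rewrite -scalerA !Kh.
pose b (a : amod A) (x : B 0%N) : A := (a : A) * alg_map A (h x).
have bP : balanced b.
  rewrite /b; split=> [a a' x|a x x'|c a x].
  - by rewrite mulrDl.
  - by rewrite hD rmorphD mulrDr.
  - by rewrite amodZE hZ rmorphM mulrA [alg_map A c * _]mulrC.
exists (tlift b) => [a|].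
  rewrite bcZ_pure /bpure tlift_pure // /b mulr1.
  by rewrite -[cga_one B]scale1r hK rmorph1 mulr1.
apply: tens_ext => [x y|//|a x]; first by rewrite tliftD // scalerDl.
rewrite tlift_pure // bcZ_pure mulr1 /b /bpure -{2}(Kh x) -tpureZ amodZE.
by rewrite mulrC.
Qed.

Definition bc_cga : cga A :=
  @Cga A T bc_cga_mul bc_cga_one bc_cga_mul_deg bc_cga_mulDl bc_cga_mulZl
    bc_cga_mulC bc_cga_mulA bc_cga_mul1 bc_cga_deg0.

(* B -> A ⊗ B, b |-> 1 ⊗ b *)
Definition cga_in (b : cring B) : cring bc_cga := fun n => bpure 1 (b n).
End BcCga.
Arguments cga_in {S} A {B} b.

(* a K-algebra homomorphism S -> B whose degree 0 component is the identity *)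
Record higher_der (K : comPzRingType) (S : alg K) (B : cga S) := HigherDer {
  hd_fun :> ahom S (res (alg_map S) (calg B));
  hd_deg0 : forall r, hd_fun r 0%N = r *: cga_one B }.

(* hd_ext is the endomorphism θ_B of condition (2); by condition (1) it is
   uniquely determined by θ, so that recording it adds no choice. *)
Record iter_hder (K : comPzRingType) (S : alg K) (B : cga S) := IterHder {
  ihd :> higher_der B;
  ihd_gen : graded_generated (fun n (x : B n) => exists r, x = ihd r n);
  ihd_ext : ahom (res (alg_map S) (calg B)) (res (alg_map S) (calg B));
  ihd_extends : forall s, ihd_ext (cring_cst B s) = ihd s;
  ihd_positive : positive ihd_ext;
  ihd_continuous : cring_continuous ihd_ext;
  ihd_iter : forall i j b,
    part ihd_ext i (part ihd_ext j b) = part ihd_ext (i + j) b *+ 'C(i + j, i) }.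

(* An affine group scheme over k, given by its coordinate ring H and the duals
   of multiplication, unit and inverse; the axioms say that they make
   Hom_k(H, A) a group for every k-algebra A. *)
Definition point_mul (k : comPzRingType) (H : alg k) (D : ahom H (atens H H))
    (A : alg k) (f g : ahom H A) : ahom H A :=
  ahom_comp (copair f g) D.

Lemma point_mul_eq (k : comPzRingType) (H : alg k) (D : ahom H (atens H H))
    (A : alg k) (f f' g g' : ahom H A) :
  f =1 f' -> g =1 g' -> point_mul D f g =1 point_mul D f' g'.
Proof.
move=> ff' gg' h; rewrite -[LHS]/(copair f g (D h)) -[RHS]/(copair f' g' (D h)).
move: (D h); apply: (@atens_ext k H H A (copair f g) (copair f' g')) => a.
- by rewrite !copair_in1.
- by rewrite !copair_in2.
Qed.

Record group_scheme (k : comPzRingType) := GroupScheme {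
  gs_ring :> alg k;
  gs_comul : ahom gs_ring (atens gs_ring gs_ring);
  gs_counit : ahom gs_ring (base_alg k);
  gs_antipode : ahom gs_ring gs_ring;
  gs_mulA : forall (A : alg k) (f g h : ahom gs_ring A),
    point_mul gs_comul f (point_mul gs_comul g h) =1
    point_mul gs_comul (point_mul gs_comul f g) h;
  gs_mul1 : forall (A : alg k) (f : ahom gs_ring A),
    point_mul gs_comul f (ahom_comp (ahom_unit A) gs_counit) =1 f;
  gs_1mul : forall (A : alg k) (f : ahom gs_ring A),
    point_mul gs_comul (ahom_comp (ahom_unit A) gs_counit) f =1 f;
  gs_mulV : forall (A : alg k) (f : ahom gs_ring A),
    point_mul gs_comul f (ahom_comp f gs_antipode) =1
    ahom_comp (ahom_unit A) gs_counit;
  gs_Vmul : forall (A : alg k) (f : ahom gs_ring A),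
    point_mul gs_comul (ahom_comp f gs_antipode) f =1
    ahom_comp (ahom_unit A) gs_counit }.
Arguments gs_comul {k} _.
Arguments gs_counit {k} _.
Arguments gs_antipode {k} _.

Section GroupBaseChange.
Variables (k k' : comPzRingType) (p : {rmorphism k -> k'}).
Let k'_alg : alg k := Alg p.

(* k' ⊗_k H as a k'-algebra *)
Definition ext_alg (H : alg k) : alg k' :=
  @Alg k' (atens k'_alg H) (in1 k'_alg H).

Fact ext_inK (H : alg k) c :
  in2 k'_alg H (alg_map H c) = alg_map (res p (ext_alg H)) c.
Proof. by rewrite ahomK. Qed.
Definition ext_in (H : alg k) : ahom H (res p (ext_alg H)) :=
  @AHom k H (res p (ext_alg H)) (in2 k'_alg H) (@ext_inK H).

Definition unit_res (A : alg k') : ahom k'_alg (res p A) :=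
  @AHom _ k'_alg (res p A) (alg_map A) (fun=> erefl).

(* Hom_k(H, A) -> Hom_k'(k' ⊗ H, A) *)
Fact ext_liftK (H : alg k) (A : alg k') (f : ahom H (res p A)) c :
  copair (unit_res A) f (alg_map (ext_alg H) c) = alg_map A c.
Proof. exact: (@copair_in1 k k'_alg H (res p A) (unit_res A) f c). Qed.
Definition ext_lift (H : alg k) (A : alg k') (f : ahom H (res p A)) :
    ahom (ext_alg H) A :=
  @AHom k' (ext_alg H) A (copair (unit_res A) f) (@ext_liftK H A f).

(* Hom_k'(k' ⊗ H, A) -> Hom_k(H, A) *)
Definition ext_restr (H : alg k) (A : alg k') (f : ahom (ext_alg H) A) :
    ahom H (res p A) :=
  ahom_comp (ahom_res p f) (ext_in H).

Lemma ext_liftE H A (f : ahom H (res p A)) h : ext_lift f (ext_in H h) = f h.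
Proof. exact: (@copair_in2 k k'_alg H (res p A) (unit_res A) f h). Qed.

Lemma ext_alg_ext H (A : alg k') (f g : ahom (ext_alg H) A) :
  ext_restr f =1 ext_restr g -> f =1 g.
Proof.
move=> fg; apply: (@atens_ext k k'_alg H A f g) => [a|b]; last exact: fg.
by rewrite -[in1 _ _ a]/(alg_map (ext_alg H) a) !ahomK.
Qed.

Variable G : group_scheme k.
Let G' := ext_alg G.

Definition ext_tens : ahom (atens G G) (res p (atens G' G')) :=
  copair (ahom_comp (ahom_res p (in1 G' G')) (ext_in G))
         (ahom_comp (ahom_res p (in2 G' G')) (ext_in G)).
Definition ext_comul : ahom G' (atens G' G') :=
  ext_lift (ahom_comp ext_tens (gs_comul G)).
Definition ext_counit : ahom G' (base_alg k') :=
  ext_lift (ahom_comp (ahom_unit (res p (base_alg k'))) (gs_counit G)).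
Definition ext_antipode : ahom G' G' :=
  ext_lift (ahom_comp (ext_in G) (gs_antipode G)).

Lemma ext_point_mul (A : alg k') (f g : ahom G' A) :
  ext_restr (point_mul ext_comul f g) =1
  point_mul (gs_comul G) (ext_restr f) (ext_restr g).
Proof.
move=> h; rewrite -[LHS]/(copair f g (ext_comul (ext_in G h))) ext_liftE.
rewrite -[RHS]/(copair (ext_restr f) (ext_restr g) (gs_comul G h)).
rewrite -[ahom_comp _ _ h]/(ext_tens (gs_comul G h)).
move: (gs_comul G h); apply: (@atens_ext k G G A
  (copair f g \o ext_tens) (copair (ext_restr f) (ext_restr g))) => a.
- rewrite copair_in1 -[LHS]/(copair f g (ext_tens (in1 G G a))).
  by rewrite /ext_tens copair_in1; exact: copair_in1.
- rewrite copair_in2 -[LHS]/(copair f g (ext_tens (in2 G G a))).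
  by rewrite /ext_tens copair_in2; exact: copair_in2.
Qed.

Lemma ext_unit (A : alg k') :
  ext_restr (ahom_comp (ahom_unit A) ext_counit) =1
  ahom_comp (ahom_unit (res p A)) (gs_counit G).
Proof.
move=> h; rewrite -[LHS]/(alg_map A (ext_counit (ext_in G h))).
by rewrite ext_liftE.
Qed.
Lemma ext_inv (A : alg k') (f : ahom G' A) :
  ext_restr (ahom_comp f ext_antipode) =1
  ahom_comp (ext_restr f) (gs_antipode G).
Proof.
move=> h; rewrite -[LHS]/(f (ext_antipode (ext_in G h))).
by rewrite ext_liftE.
Qed.

Fact ext_mulA (A : alg k') (f g h : ahom G' A) :
  point_mul ext_comul f (point_mul ext_comul g h) =1
  point_mul ext_comul (point_mul ext_comul f g) h.
Proof.
apply: ext_alg_ext => x; rewrite !ext_point_mul.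
rewrite (point_mul_eq _ (frefl _) (ext_point_mul g h)).
rewrite [RHS](point_mul_eq _ (ext_point_mul f g) (frefl _)).
exact: gs_mulA.
Qed.
Fact ext_mul1 (A : alg k') (f : ahom G' A) :
  point_mul ext_comul f (ahom_comp (ahom_unit A) ext_counit) =1 f.
Proof.
apply: ext_alg_ext => x; rewrite ext_point_mul.
by rewrite (point_mul_eq _ (frefl _) (ext_unit A)) gs_mul1.
Qed.
Fact ext_1mul (A : alg k') (f : ahom G' A) :
  point_mul ext_comul (ahom_comp (ahom_unit A) ext_counit) f =1 f.
Proof.
apply: ext_alg_ext => x; rewrite ext_point_mul.
by rewrite (point_mul_eq _ (ext_unit A) (frefl _)) gs_1mul.
Qed.
Fact ext_mulV (A : alg k') (f : ahom G' A) :
  point_mul ext_comul f (ahom_comp f ext_antipode) =1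
  ahom_comp (ahom_unit A) ext_counit.
Proof.
apply: ext_alg_ext => x; rewrite ext_point_mul ext_unit.
by rewrite (point_mul_eq _ (frefl _) (ext_inv f)) gs_mulV.
Qed.
Fact ext_Vmul (A : alg k') (f : ahom G' A) :
  point_mul ext_comul (ahom_comp f ext_antipode) f =1
  ahom_comp (ahom_unit A) ext_counit.
Proof.
apply: ext_alg_ext => x; rewrite ext_point_mul ext_unit.
by rewrite (point_mul_eq _ (ext_inv f) (frefl _)) gs_Vmul.
Qed.

Definition gs_ext : group_scheme k' :=
  @GroupScheme k' G' ext_comul ext_counit ext_antipode
    ext_mulA ext_mul1 ext_1mul ext_mulV ext_Vmul.
End GroupBaseChange.

Definition flat (k : comPzRingType) (A : alg k) : Prop :=
  forall (M N : lmodType k) (f : {linear M -> N}),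
    injective f -> injective (bc_fmap A f).

Definition faithfully_flat (k : comPzRingType) (A : alg k) : Prop :=
  flat A /\
  forall M : lmodType k, (forall x : bc A M, x = 0) -> forall m : M, m = 0.

(* A coaction rho : R -> R ⊗ H lets a point g of G act on a point x of Spec R by
   x.g = (x, g) o rho. This is a right action on Spec R, since functions are
   acted upon on the left. *)
Definition point_act (k : comPzRingType) (G : group_scheme k) (R : alg k)
    (rho : ahom R (atens R G)) (A : alg k) (x : ahom R A) (g : ahom G A) :
  ahom R A := ahom_comp (copair x g) rho.

(* Spec R is a torsor under G for the action rho: Spec R -> Spec k is
   faithfully flat and (x, g) |-> (x, x.g) is an isomorphism
   Spec R x G -> Spec R x Spec R, that is, a ⊗ b |-> (a ⊗ 1) rho(b) is an
   isomorphism R ⊗ R -> R ⊗ H. *)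
Record is_torsor (k : comPzRingType) (G : group_scheme k) (R : alg k)
    (rho : ahom R (atens R G)) : Prop := IsTorsor {
  torsor_actA : forall (A : alg k) (x : ahom R A) (g h : ahom G A),
    point_act rho (point_act rho x g) h =1
    point_act rho x (point_mul (gs_comul G) g h);
  torsor_act1 : forall (A : alg k) (x : ahom R A),
    point_act rho x (ahom_comp (ahom_unit A) (gs_counit G)) =1 x;
  torsor_flat : faithfully_flat R;
  torsor_iso : bijective (copair (in1 R G) rho) }.

Definition alg_generated (k : comPzRingType) (A : alg k) (X : A -> Prop) : Prop :=
  forall P : A -> Prop,
    (forall a, X a -> P a) -> (forall c, P (alg_map A c)) ->
    (forall a b, P a -> P b -> P (a + b)) ->
    (forall a b, P a -> P b -> P (a * b)) ->
  forall a, P a.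

Definition finite_type (k : comPzRingType) (A : alg k) : Prop :=
  exists s : seq A, alg_generated (fun a => a \in s).

Definition in_GL (A : comPzRingType) n (Y : 'M[A]_n) : Prop :=
  exists d, d * \det Y = 1.

Section Setting.
Variables (K F : fieldType) (iota : {rmorphism K -> F}).

Definition baseF : alg K := @Alg K F iota.

Variable Om : cga F.
Variable theta : @iter_hder K baseF Om.

Record theta_ring := ThetaRing {
  tr_alg :> alg F;
  tr_theta : @iter_hder K (res iota tr_alg) (bc_cga tr_alg Om);
  tr_theta_ext : forall t : F,
    tr_theta (alg_map tr_alg t) = cga_in tr_alg (theta t) }.

Definition is_const (R : theta_ring) (r : R) : Prop :=
  tr_theta R r = cring_cst (bc_cga R Om) r.

Definition is_ideal (A : comPzRingType) (I : A -> Prop) : Prop :=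
  [/\ I 0, forall a b, I a -> I b -> I (a + b)
    & forall a b, I b -> I (a * b)].

(* the image of I ⊗ M in A ⊗ M *)
Definition in_ideal_tens (A : alg F) (I : A -> Prop) (M : lmodType F)
    (x : bc A M) : Prop :=
  exists2 s : seq (A * M), (forall p, p \in s -> I p.1)
    & x = \sum_(p <- s) bpure p.1 p.2.

Definition theta_ideal (R : theta_ring) (I : R -> Prop) : Prop :=
  is_ideal I /\ forall k r, I r -> @in_ideal_tens R I (Om k) (tr_theta R r k).

Definition theta_simple (R : theta_ring) : Prop :=
  forall I : R -> Prop, theta_ideal I ->
    (forall r, I r -> r = 0) \/ (forall r, I r).

(* the homogeneous component A_k of a matrix, in Mat_n(Om_k) *)
Definition mx_comp n (k : nat) (A : 'M[cring Om]_n) : 'M[cring Om]_n :=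
  map_mx (fun a : cring Om => homg (a k)) A.

Definition iter_equation n (A : 'M[cring Om]_n) : Prop :=
  [/\ in_GL A, mx_comp 0 A = 1%:M
    & forall k l, mx_comp (k + l) A *+ 'C(k + l, k) =
        \sum_(i < l.+1)
          map_mx (part (ihd_ext theta) i) (mx_comp k A) *m mx_comp (l - i) A].

(* The condition C_R = K is stated through the structure map K -> R, whose
   injectivity is part of it; in particular R <> 0. *)
Record is_PPV_for n (A : 'M[cring Om]_n) (R : theta_ring) : Prop := IsPPVFor {
  ppv_simple : theta_simple R;
  ppv_solution : exists (Y : 'M[R]_n) (d : R),
    [/\ d * \det Y = 1,
        map_mx (tr_theta R) Y =
          map_mx (cga_in R) A *m map_mx (cring_cst (bc_cga R Om)) Y
      & @alg_generated F R (fun r => r = d \/ exists i j, r = Y i j)];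
  ppv_const : forall r : R,
    is_const r <-> exists! c : K, r = alg_map R (iota c) }.

Definition is_PPV (R : theta_ring) : Prop :=
  exists n (A : 'M[cring Om]_n), iter_equation A /\ is_PPV_for A R.

Section Galois.
Variable R : theta_ring.

Definition RK : alg K := res iota R.

Section Extension.
Variable L : alg K.

Definition extF : alg K := atens baseF L.
Definition baseF_R : ahom baseF RK := @AHom K baseF RK (alg_map R) (fun=> erefl).

(* R_L as an F_L-algebra, and as an F-algebra *)
Definition extR : alg extF :=
  @Alg extF (atens RK L) (atens_map baseF_R (ahom_id L)).
Definition extRF : alg F := res (in1 baseF L) extR.

(* R -> R_L, r |-> r ⊗ 1 *)
Fact R_extK t : in1 RK L (alg_map R t) = alg_map extRF t.
Proof.
rewrite -[RHS]/(atens_map baseF_R (ahom_id L) (in1 baseF L t)).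
by rewrite /atens_map copair_in1.
Qed.
Definition R_ext : ahom R extRF := @AHom F R extRF (in1 RK L) R_extK.

(* theta(r ⊗ a) = theta(r) ⊗ a, in R_L ⊗_F Om; here theta_R(r) ⊗ a is a times
   the image of theta_R(r) under R ⊗_F Om -> R_L ⊗_F Om *)
Definition ext_theta (x : extR) : cring (bc_cga extRF Om) := fun n =>
  tlift (fun (r : amod RK) (a : amod L) =>
    (in2 RK L (a : L) : extRF) *: bc_map R_ext (tr_theta R (r : R) n)) x.

Lemma ext_theta_pure r a n :
  ext_theta (apure r a) n = (in2 RK L a : extRF) *: bc_map R_ext (tr_theta R r n).
Proof.
rewrite /ext_theta tlift_pure //; split=> [x x' b|x b b'|c x b].
- by rewrite rmorphD cringDE bc_mapD scalerDr.
- by rewrite rmorphD scalerDl.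
rewrite !amodZE; have -> : tr_theta R (alg_map RK c * (x : R)) =
    cring_cst (bc_cga R Om) (alg_map R (iota c)) * tr_theta R x.
  by rewrite rmorphM; congr (_ * _); exact: (ahomK (tr_theta R) c).
rewrite cring_cstM bc_mapZ scalerA rmorphM mulrC ahomK; congr (_ * _ *: _).
by rewrite ahomK -R_extK.
Qed.

Record theta_aut := ThetaAut {
  ta_fun :> ahom extR extR;
  ta_bij : bijective ta_fun;
  ta_theta : forall x n,
    ext_theta (ta_fun x) n =
    bc_map (ahom_res (in1 baseF L) ta_fun) (ext_theta x n) }.
End Extension.

(* An affine group scheme of finite type representing the group functor
   L |-> Aut^theta(R_L / F_L). *)
Record galois_group_scheme := GaloisGroupScheme {
  gal_group :> group_scheme K;
  gal_finite_type : finite_type gal_group;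
  gal_aut : forall L : alg K, ahom gal_group L -> theta_aut L;
  gal_aut_inj : forall (L : alg K) (f g : ahom gal_group L),
    gal_aut f =1 gal_aut g <-> f =1 g;
  gal_aut_surj : forall (L : alg K) (s : theta_aut L),
    exists f : ahom gal_group L, gal_aut f =1 s;
  gal_aut_nat : forall (L L' : alg K) (u : ahom L L') (f : ahom gal_group L) x,
    gal_aut (ahom_comp u f) (atens_map (ahom_id RK) u x) =
    atens_map (ahom_id RK) u (gal_aut f x);
  gal_aut_mul : forall (L : alg K) (f g : ahom gal_group L),
    gal_aut (point_mul (gs_comul gal_group) f g) =1 gal_aut f \o gal_aut g }.

Variable G : galois_group_scheme.

(* the coaction R -> R ⊗_K K[G] of the universal point *)
Definition gal_coact : ahom R (extRF G) :=
  ahom_comp (ahom_res (in1 baseF G) (gal_aut (ahom_id G))) (R_ext G).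

(* R ⊗_K K[G] ≅ R ⊗_F (F ⊗_K K[G]) *)
Definition ext_regroup_K :
    ahom (atens RK G) (res iota (atens R (ext_alg iota G))) :=
  copair (ahom_res iota (in1 R (ext_alg iota G)))
         (ahom_comp (ahom_res iota (in2 R (ext_alg iota G))) (ext_in iota G)).
Fact ext_regroupK t :
  ext_regroup_K (alg_map (extRF G) t) = alg_map (atens R (ext_alg iota G)) t.
Proof. by rewrite -R_extK /ext_regroup_K copair_in1 /= -/(in1_fun _ _). Qed.
Definition ext_regroup : ahom (extRF G) (atens R (ext_alg iota G)) :=
  @AHom F (extRF G) (atens R (ext_alg iota G)) ext_regroup_K ext_regroupK.

(* the coaction of F ⊗_K K[G], i.e. the action of G_F on Spec R *)
Definition gal_action : ahom R (atens R (gs_ext iota G)) :=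
  ahom_comp ext_regroup gal_coact.

End Galois.
End Setting.

(* Main.v *)
(* Let C be the ring of constants of R ⊗_F R. As R is theta-simple with constants
   K, the multiplication mu : R ⊗_K C -> R ⊗_F R is injective; it is surjective
   because 1 ⊗ Y = (Y ⊗ 1) Z with a constant matrix Z. So r |-> mu^-1(1 ⊗ r)
   extends to a theta-automorphism of R_C, that is, to a C-point psi of the Galois
   group G. Conversely a ⊗ b |-> (a ⊗ 1) rho(b) maps C to the constants K[G] of
   R ⊗_K K[G], which gives phi : C -> K[G]. Representability yields
   phi psi = 1, and mu (id ⊗ psi) is the inverse of the torsor map.
   Multilinear algebra over a field is reduced to the linear forms on one factor:
   x in M ⊗ N is the sum of the (id ⊗ lam_i)(x) ⊗ v_i for finitely many
   v_i in N and lam_i in N^*. *)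
From HB Require Import structures.
Require Import Defs.
From mathcomp Require Import all_boot all_algebra.
From mathcomp Require Import boolp classical_sets.
Set Implicit Arguments.
Unset Strict Implicit.
Unset Printing Implicit Defensive.
Import GRing.Theory.
Local Open Scope ring_scope.

(** * Tensor products over a field *)

Lemma linear_pack (R : pzRingType) (U V : lmodType R) (f : U -> V) :
  linear f -> exists g : {linear U -> V}, g =1 f.
Proof.
move=> fL; pose h := GRing.isLinear.Build _ _ _ _ f fL.
pose g : {linear U -> V} := HB.pack f h.
by exists g.
Qed.

Section VectorSpaces.
Variable k : fieldType.

(** By Zorn's lemma there is a subspace [A] maximal among those avoiding [w]. It is a complement of
    the line [k w], and the form is the coordinate along [w]. *)
Lemma exists_functional (M : lmodType k) (w : M) :
  w <> 0 -> exists lam : {linear M -> k^o}, lam w = 1.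
Proof.
(* The empty set satisfies [sub], so the union of an empty chain is admissible. That the maximal [A]
   contains 0 is proved afterwards: otherwise [A] is empty and properly contained in [[set 0]]. *)
move=> w0; pose sub (W : set M) := forall a x y, W x -> W y -> W (a *: x + y).
have [A [[Asub Aw] Amax]] : exists A : set M, (sub A /\ ~ A w) /\
    forall B, (A `<` B)%classic -> ~ (sub B /\ ~ B w).
  apply: (@Zorn_bigcup _ (fun W => sub W /\ ~ W w)) => FF FFP FFtot; split.
    move=> a x y [X FX Xx] [Y FY Yy].
    have [XY|YX] := FFtot _ _ FX FY.
      by exists Y => //; apply: (FFP _ FY).1 => //; exact: XY.
    by exists X => //; apply: (FFP _ FX).1 => //; exact: YX.
  by case=> X FX; exact: (FFP _ FX).2.
have A0 : A 0.
  apply: contrapT => nA0; apply: (Amax [set 0]%classic); last first.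
    by split=> [a x y -> ->|]; rewrite ?scaler0 ?addr0.
  split=> [x Ax|/(_ 0 erefl)//].
  by case: nA0; rewrite -(addNr x) -scaleN1r; exact: Asub.
have AZ a x : A x -> A (a *: x) by move=> Ax; rewrite -[_ *: _]addr0; exact: Asub.
have AB x y : A x -> A y -> A (x - y).
  by move=> Ax Ay; rewrite addrC -scaleN1r; exact: Asub.
have Adec x : exists a : k^o, A (x - a *: w).
  (* [B] is [A + k x], strictly larger than [A]. If it contained [w], then either [w] would lie in
     [A] or [x] would be a multiple of [w] modulo [A]. *)
  apply: contrapT => nx; pose B : set M := fun y => exists c b, A b /\ y = c *: x + b.
  apply: (Amax B); last split.
  - split=> [y Ay|AB'].
      by exists 0, y; rewrite scale0r add0r.
    apply: nx; exists 0; rewrite scale0r subr0; apply: AB'.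
    by exists 1, 0; rewrite scale1r addr0.
  - move=> a _ _ [c [b [Ab ->]]] [c' [b' [Ab' ->]]].
    exists (a * c + c'), (a *: b + b'); split; first exact: Asub.
    by rewrite scalerDr scalerDl scalerA addrACA.
  case=> c [b [Ab wE]]; have [c0|c0] := eqVneq c 0.
    by apply: Aw; rewrite wE c0 scale0r add0r.
  apply: nx; exists c^-1; rewrite wE scalerDr scalerA mulVf // scale1r.
  rewrite opprD addNKr -scalerN; apply: (AZ); rewrite -scaleN1r; exact: (AZ).
have Auniq x a a' : A (x - a *: w) -> A (x - a' *: w) -> a = a'.
  move=> Aa Aa'; apply/eqP; rewrite -subr_eq0; apply: contraT => aa'.
  have := AB _ _ Aa' Aa; rewrite opprB addrC addrA subrK -scalerBl => /(AZ (a - a')^-1).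
  by rewrite scalerA mulVf // scale1r.
have [f fP] := choice Adec.
have [|lam lamE] := @linear_pack _ M k^o f.
  move=> a x y; apply: (Auniq (a *: x + y)) => //.
  rewrite scalerDl -scalerA opprD addrACA -scalerBr; exact: Asub.
exists lam; rewrite lamE; apply: (Auniq w) => //.
by rewrite scale1r subrr.
Qed.

(** Dual bases are built one vector at a time: if the operator [P] obtained so far does not fix [u],
    the pair of [u - P u] and a suitable form is added. *)
Lemma exists_projection (M : lmodType k) (vs : seq M) :
  exists s : seq (M * {linear M -> k^o}),
    forall v, v \in vs -> v = \sum_(p <- s) p.2 v *: p.1.
Proof.
elim: vs => [|u vs [s sP]]; first by exists [::].
pose P v := \sum_(p <- s) p.2 v *: p.1.
have [u0|u0] := pselect (u - P u = 0).
  exists s => v; rewrite inE => /orP[/eqP->|]; last exact: sP.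
  by apply/eqP; rewrite -subr_eq0; apply/eqP.
have [lam lamu] := exists_functional u0.
(* The new form vanishes on the earlier vectors, since [P] fixes them, and takes the value 1 at
   [u]. *)
have [|mu muE] := @linear_pack _ M k^o (fun v => lam (v - P v)).
  move=> a x y; rewrite -linearP; congr (lam _).
  rewrite scalerBr [RHS]addrACA -opprD; congr (_ - _).
  rewrite /P scaler_sumr -big_split; apply: eq_bigr => p _ /=.
  by rewrite linearP scalerDl scalerA.
exists ((u - P u, mu) :: s) => v; rewrite big_cons /= muE -/(P v) inE.
case/orP=> [/eqP->|/sP vE]; first by rewrite lamu scale1r subrK.
by rewrite -[P v]vE subrr linear0 scale0r add0r.
Qed.
End VectorSpaces.

(** * Contraction of tensors by linear forms on one factor *)

Section Contraction.
Variables (k : comPzRingType) (M N : lmodType k).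

Definition rcontr (lam : {linear N -> k^o}) (x : tens M N) : M :=
  tlift (fun m n => (lam n : k) *: m) x.
Definition lcontr (lam : {linear M -> k^o}) (x : tens M N) : N :=
  tlift (fun m n => (lam m : k) *: n) x.

Fact rcontrP (lam : {linear N -> k^o}) :
  balanced (fun (m : M) (n : N) => (lam n : k) *: m).
Proof.
split=> [m m' n|m n n'|a m n]; first by rewrite scalerDr.
  by rewrite linearD scalerDl.
by rewrite scalerA mulrC linearZ.
Qed.
Fact lcontrP (lam : {linear M -> k^o}) :
  balanced (fun (m : M) (n : N) => (lam m : k) *: n).
Proof.
split=> [m m' n|m n n'|a m n]; first by rewrite linearD scalerDl.
  by rewrite scalerDr.
by rewrite scalerA mulrC linearZ.
Qed.

Lemma rcontr_pure lam m n : rcontr lam (tpure m n) = (lam n : k) *: m.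
Proof. exact: tlift_pure (rcontrP lam) _ _. Qed.
Lemma lcontr_pure lam m n : lcontr lam (tpure m n) = (lam m : k) *: n.
Proof. exact: tlift_pure (lcontrP lam) _ _. Qed.
Lemma rcontrD lam : {morph rcontr lam : x y / x + y}.
Proof. exact: tliftD (rcontrP lam). Qed.
Lemma lcontrD lam : {morph lcontr lam : x y / x + y}.
Proof. exact: tliftD (lcontrP lam). Qed.
Lemma rcontr0 lam : rcontr lam 0 = 0.
Proof. exact: tlift0 (rcontrP lam). Qed.
Lemma lcontr0 lam : lcontr lam 0 = 0.
Proof. exact: tlift0 (lcontrP lam). Qed.

Lemma tpure_suml I (r : seq I) (f : I -> M) (n : N) :
  tpure (\sum_(i <- r) f i) n = \sum_(i <- r) tpure (f i) n.
Proof.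
by apply: (big_morph (tpure^~ n)) => [x y|]; [exact: tpureDl|exact: tpure0l].
Qed.
Lemma tpure_sumr I (r : seq I) (f : I -> N) (m : M) :
  tpure m (\sum_(i <- r) f i) = \sum_(i <- r) tpure m (f i).
Proof.
apply: (big_morph (tpure m)) => [x y|]; first exact: tpureDr.
by apply: additive_at0 => *; exact: tpureDr.
Qed.
End Contraction.

Section Duality.
Variables (k : fieldType) (M N : lmodType k).

(** Only finitely many second factors occur in a list representing [x]. Expand each of them by
    [exists_projection], move the scalars to the left and exchange the sums. *)
Lemma rcontr_dual (x : tens M N) : exists s : seq (N * {linear N -> k^o}),
  x = \sum_(p <- s) tpure (rcontr p.2 x) p.1.
Proof.
elim/tens_clsW: x => t; have [s sP] := exists_projection [seq p.2 | p <- t].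
exists s; rewrite tens_cls_sum.
transitivity (\sum_(q <- t) \sum_(p <- s) tpure ((p.2 q.2 : k) *: q.1) p.1).
  rewrite big_seq [RHS]big_seq; apply: eq_bigr => q qt.
  rewrite {1}(sP q.2 (map_f _ qt)) tpure_sumr.
  by apply: eq_bigr => p _; rewrite tpureZ.
rewrite exchange_big; apply: eq_bigr => p _.
by rewrite -tpure_suml /rcontr -tens_cls_sum tlift_cls //; exact: rcontrP.
Qed.

Lemma lcontr_dual (x : tens M N) : exists s : seq (M * {linear M -> k^o}),
  x = \sum_(p <- s) tpure p.1 (lcontr p.2 x).
Proof.
elim/tens_clsW: x => t; have [s sP] := exists_projection [seq p.1 | p <- t].
exists s; rewrite tens_cls_sum.
transitivity (\sum_(q <- t) \sum_(p <- s) tpure p.1 ((p.2 q.1 : k) *: q.2)).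
  rewrite big_seq [RHS]big_seq; apply: eq_bigr => q qt.
  rewrite {1}(sP q.1 (map_f _ qt)) tpure_suml.
  by apply: eq_bigr => p _; rewrite tpureZ.
rewrite exchange_big; apply: eq_bigr => p _.
by rewrite -tpure_sumr /lcontr -tens_cls_sum tlift_cls //; exact: lcontrP.
Qed.

Lemma rcontr_eq0 (x : tens M N) : (forall lam, rcontr lam x = 0) -> x = 0.
Proof.
move=> x0; have [s ->] := rcontr_dual x.
by rewrite big1 // => p _; rewrite x0 tpure0l.
Qed.

Lemma lcontr_eq0 (x : tens M N) : (forall lam, lcontr lam x = 0) -> x = 0.
Proof.
move=> x0; have [s ->] := lcontr_dual x; rewrite big1 // => p _; rewrite x0.
by apply: additive_at0 => *; exact: tpureDr.
Qed.
End Duality.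

(** Contraction by a form on [A] commutes with [id ⊗ f], so every contraction of a kernel element is
    killed by the injective [f]. Contractions detect zero. *)
Lemma flat_field (k : fieldType) (A : alg k) : flat A.
Proof.
move=> M N f finj; have bc_fmapD : {morph bc_fmap A f : x y / x + y}.
  exact: tliftD (bc_fmapP A f).
have lcontr_fmap lam x : lcontr lam (bc_fmap A f x) = f (lcontr lam x).
  move: x; apply: tens_ext => [x y|x y|a m]; rewrite ?bc_fmapD ?lcontrD ?linearD //.
  by rewrite -/(bpure _ _) bc_fmap_pure /bpure !lcontr_pure linearZ.
move=> x y fxy; apply/eqP; rewrite -subr_eq0; apply/eqP/lcontr_eq0 => lam.
apply: finj; rewrite -lcontr_fmap linear0.
suff -> : bc_fmap A f (x - y) = 0 by rewrite lcontr0.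
by apply: (addIr (bc_fmap A f y)); rewrite -bc_fmapD subrK add0r.
Qed.

(** A form taking the value 1 at the unit of [A] gives a retraction of [m |-> 1 ⊗ m]. *)
Lemma faithfully_flat_field (k : fieldType) (A : alg k) :
  (1 : A) <> 0 -> faithfully_flat A.
Proof.
move=> A1; split=> [|M M0 m]; first exact: flat_field.
have [lam lam1] := @exists_functional k (amod A) 1 A1.
by rewrite -[m]scale1r -lam1 -lcontr_pure [tpure _ _]M0 lcontr0.
Qed.

(** * Algebras with operators and only trivial stable ideals *)

Definition lmap (k : comPzRingType) (M M' N : lmodType k) (f : {linear M -> M'})
    (x : tens M N) : tens M' N :=
  tlift (fun m n => tpure (f m) n) x.

Section LeftMap.
Variables (k : comPzRingType) (M M' N : lmodType k) (f : {linear M -> M'}).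

Fact lmapP : balanced (fun (m : M) (n : N) => tpure (f m) n).
Proof.
split=> [m m' n|m n n'|a m n]; first by rewrite linearD tpureDl.
  by rewrite tpureDr.
by rewrite -tpureZ linearZ.
Qed.
Lemma lmap_pure m (n : N) : lmap f (tpure m n) = tpure (f m) n.
Proof. exact: tlift_pure lmapP _ _. Qed.
Lemma lmapD : {morph lmap f : x y / x + y :> tens M N >-> x + y}.
Proof. exact: tliftD lmapP. Qed.
Lemma lmap0 : lmap f (0 : tens M N) = 0.
Proof. exact: tlift0 lmapP. Qed.
Lemma rcontr_lmap (lam : {linear N -> k^o}) x :
  rcontr lam (lmap f x) = f (rcontr lam x).
Proof.
move: x; apply: tens_ext => [x y|x y|m n].
- by rewrite lmapD rcontrD.
- by rewrite rcontrD linearD.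
by rewrite lmap_pure !rcontr_pure linearZ.
Qed.
End LeftMap.

Section SimpleAlgebra.
Variables (k : fieldType) (R : alg k) (X : Type).
Variable D : X -> {linear amod R -> amod R}.
Hypothesis D1 : forall i, D i (1 : R) = 0.
Hypothesis D_simple : forall I : R -> Prop, is_ideal I ->
  (forall i r, I r -> I (D i r)) -> (forall r, I r -> r = 0) \/ forall r, I r.
Hypothesis D_const : forall r, (forall i, D i r = 0) ->
  exists c, r = alg_map R c.
Variable V : lmodType k.

(** The operators commute with contraction, so all coefficients of [x] in a dual expansion are
    constants of [R], that is, scalars; these pass through the tensor sign. *)
Lemma const_bc (x : bc R V) : (forall i, lmap (D i) x = 0) ->
  exists v, x = bpure 1 v.
Proof.
move=> Dx0; have [s xE] := rcontr_dual x.
have xc p : exists c, rcontr p x = alg_map R c.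
  by apply: D_const => i; rewrite -rcontr_lmap Dx0 rcontr0.
rewrite xE; elim: s {xE} => [|p s [v vE]].
  exists 0; rewrite big_nil; apply/esym.
  by apply: additive_at0 => *; exact: tpureDr.
have [c cE] := xc p.2; exists (c *: p.1 + v); rewrite big_cons vE cE.
rewrite /bpure tpureDr; congr (_ + _).
by rewrite -tpureZ amodZE mulr1.
Qed.

Record stable_submod (J : bc R V -> Prop) : Prop := StableSubmod {
  stable0 : J 0;
  stableD : forall x y, J x -> J y -> J (x + y);
  stableZ : forall r x, J x -> J (r *: x);
  stable_lmap : forall i x, J x -> J (lmap (D i) x) }.

(** The [R]-submodule generated by the [1 ⊗ v]. The recursion on the list singles out the
    coefficient of its head, on which [stable_submod_eq0] proceeds by induction. *)
Fixpoint rspan (vs : seq V) (x : bc R V) : Prop :=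
  if vs is v :: vs' then exists r y, rspan vs' y /\ x = bpure r v + y
  else x = 0.

Lemma rspan_stable vs : stable_submod (rspan vs).
Proof.
elim: vs => [|v vs [IH0 IHD IHZ IHm]].
  split=> /= [//|x y -> ->|r x ->|i x ->].
  - by rewrite addr0.
  - by rewrite scaler0.
  - by rewrite lmap0.
split=> /= [|x y|r x|i x].
- by exists 0, 0; split=> //; rewrite addr0 [bpure 0 v]tpure0l.
- case=> r [y' [y'W ->]] [r' [y'' [y''W ->]]].
  exists (r + r'), (y' + y''); split; first exact: IHD.
  by rewrite addrACA; congr (_ + _); rewrite /bpure -tpureDl.
- case=> r' [y' [y'W ->]]; exists (r * r'), (r *: y'); split; first exact: IHZ.
  by rewrite scalerDr bcZ_pure.
case=> r [y' [y'W ->]]; exists (D i r), (lmap (D i) y'); split; first exact: IHm.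
by rewrite lmapD lmap_pure.
Qed.

Lemma rspan_cls (s : seq (amod R * V)) : rspan [seq p.2 | p <- s] (tens_cls s).
Proof.
elim: s => [//|[r v] s IHs] /=; exists r, (tens_cls s); split=> //.
by rewrite !tens_cls_sum big_cons.
Qed.

(* Induction on the length of a tensor x of J: as R is simple, if the coefficient
   of v in x is not 0, then J contains a tensor z of the same shape where it is 1;
   the D_i z are shorter, hence 0, so that z is constant and vanishes. *)
Lemma stable_submod_eq0 (J : bc R V -> Prop) : stable_submod J ->
  (forall v, J (bpure 1 v) -> v = 0) -> forall x, J x -> x = 0.
Proof.
move=> [J0 JD JZ Jm] Jconst.
suff main vs : forall x, J x -> rspan vs x -> x = 0.
  by elim/tens_clsW => s Js; apply: main Js (rspan_cls s).
elim: vs => [//|v vs IHvs] x Jx [r [y [Wy xE]]].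
have [W0 WD WZ Wm] := rspan_stable vs.
(* The ideal of all coefficients of [v] occurring in [J]; it is stable because [D i] acts
   coefficientwise. *)
pose I a := exists2 y, rspan vs y & J (bpure a v + y).
have Ir : I r by exists y; rewrite -?xE.
have [||Ieq0|/(_ 1) [z Wz Jz]] := @D_simple I.
- split=> [|a b [y1 Wy1 Jy1] [y2 Wy2 Jy2]|a b [y1 Wy1 Jy1]].
  + by exists 0; rewrite // addr0 [bpure 0 v]tpure0l.
  + exists (y1 + y2); first exact: WD.
    have -> : bpure (a + b) v = bpure a v + bpure b v by exact: tpureDl.
    by rewrite addrACA; exact: JD.
  + by exists (a *: y1); [exact: WZ|rewrite -bcZ_pure -scalerDr; exact: JZ].
- move=> i a [y1 Wy1 Jy1]; exists (lmap (D i) y1); first exact: Wm.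
  by have := Jm i _ Jy1; rewrite lmapD lmap_pure.
- by apply: IHvs => //; rewrite xE (Ieq0 r Ir) [bpure 0 v]tpure0l add0r.
have z0 : bpure 1 v + z = 0.
  have [i|u zE] := @const_bc (bpure 1 v + z).
    apply: IHvs; first exact: Jm.
    by rewrite lmapD lmap_pure D1 tpure0l add0r; exact: Wm.
  rewrite zE (Jconst u) -?zE //.
  by apply: additive_at0 => *; exact: tpureDr.
(* Replacing [1 ⊗ v] by [- z] places [x] in the span of the shorter list. *)
apply: IHvs => //; rewrite xE -[r in bpure r]mulr1 -bcZ_pure.
move/eqP: z0; rewrite addr_eq0 => /eqP ->; apply: WD => //.
by rewrite -scaleN1r; apply: (WZ); exact: (WZ).
Qed.
End SimpleAlgebra.

(** * Functoriality of base change of cgas *)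

Lemma bc_contrZ (k : comPzRingType) (A : alg k) (M : lmodType k)
    (lam : {linear M -> k^o}) (a : A) (x : bc A M) :
  rcontr lam (a *: x) = a * (rcontr lam x : A) :> A.
Proof.
move: x; apply: tens_ext => [x y|x y|b m].
- by rewrite scalerDr rcontrD.
- by rewrite rcontrD mulrDr.
by rewrite -/(bpure _ _) bcZ_pure /bpure !rcontr_pure !amodZE mulrCA.
Qed.

Lemma bc_contr_map (k : comPzRingType) (A B : alg k) (f : ahom A B)
    (M : lmodType k) (lam : {linear M -> k^o}) (x : bc A M) :
  rcontr lam (bc_map f x) = f (rcontr lam x) :> B.
Proof.
move: x; apply: tens_ext => [x y|x y|a m].
- by rewrite bc_mapD rcontrD.
- by rewrite rcontrD rmorphD.
by rewrite -/(bpure _ _) bc_map_pure /bpure !rcontr_pure !amodZE rmorphM ahomK.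
Qed.

Lemma bc_map_comp (k : comPzRingType) (A B C : alg k) (f : ahom A B)
    (g : ahom B C) (M : lmodType k) (x : bc A M) :
  bc_map g (bc_map f x) = bc_map (ahom_comp g f) x.
Proof.
move: x; apply: tens_ext => [x y|x y|a m]; rewrite ?bc_mapD //.
by rewrite -/(bpure _ _) !bc_map_pure.
Qed.

Lemma eq_bc_map (k : comPzRingType) (A B : alg k) (f g : ahom A B)
    (M : lmodType k) : f =1 g -> @bc_map k A B f M =1 @bc_map k A B g M.
Proof.
move=> fg; apply: tens_ext => [x y|x y|a m]; rewrite ?bc_mapD //.
by rewrite -/(bpure _ _) !bc_map_pure fg.
Qed.

Lemma bc_map_id (k : comPzRingType) (A : alg k) (M : lmodType k) :
  @bc_map k A A (ahom_id A) M =1 id.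
Proof.
apply: tens_ext => [x y|//|a m]; first by rewrite bc_mapD.
by rewrite -/(bpure _ _) bc_map_pure.
Qed.

Lemma cring_cst0 (S : comPzRingType) (B : cga S) (s : S) :
  cring_cst B s 0%N = s *: cga_one B.
Proof. exact: homg_id. Qed.
Lemma cring_cstS (S : comPzRingType) (B : cga S) (s : S) n : cring_cst B s n.+1 = 0.
Proof. exact: homg_neq. Qed.

Section CgaFunctoriality.
Variables (k : comPzRingType) (Om : cga k).

Variables (A B : alg k) (f : ahom A B).

Lemma bc_map_mul i j n (x : bc_cga A Om i) (y : bc_cga A Om j) :
  bc_map f (cga_mul n x y) = cga_mul n (bc_map f x : bc_cga B Om i) (bc_map f y).
Proof.
move: x; apply: tens_ext => [x x'|x x'|a x].
- by rewrite cga_mulDl bc_mapD.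
- by rewrite bc_mapD cga_mulDl.
move: y; apply: tens_ext => [y y'|y y'|b y].
- by rewrite cga_mulDr bc_mapD.
- by rewrite bc_mapD cga_mulDr.
rewrite -!/(bpure _ _) !bc_map_pure /= !bc_cga_mul_pure bc_map_pure.
by rewrite rmorphM.
Qed.

Definition cmap (a : cring (bc_cga A Om)) : cring (bc_cga B Om) :=
  fun n => bc_map f (a n).

Fact cmap_additive : zmod_morphism cmap.
Proof.
move=> a b; apply: (addIr (cmap b)); rewrite subrK.
apply: cring_ext => n; rewrite cringDE /cmap -bc_mapD; congr (bc_map f _).
exact: (congr1 (fun c : cring (bc_cga A Om) => c n) (subrK b a)).
Qed.
Lemma cmap_cst (a : A) : cmap (cring_cst _ a) = cring_cst _ (f a).
Proof.
apply: cring_ext => -[|n]; rewrite /cmap.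
  by rewrite !cring_cst0 bc_mapZ bc_map_pure rmorph1.
by rewrite !cring_cstS; apply: additive_at0; exact: bc_mapD.
Qed.
Fact cmap_mult : monoid_morphism cmap.
Proof.
split=> [|a b].
  by rewrite -[1](rmorph1 (cring_cst _)) cmap_cst !rmorph1.
apply: cring_ext => n; rewrite /cmap !cringME.
rewrite (big_morph _ (@bc_mapD _ _ _ f _) (id1 := 0)).
  by apply: eq_bigr => i _; rewrite bc_map_mul.
by apply: additive_at0; exact: bc_mapD.
Qed.
HB.instance Definition _ := GRing.isZmodMorphism.Build _ _ cmap cmap_additive.
HB.instance Definition _ := GRing.isMonoidMorphism.Build _ _ cmap cmap_mult.

Lemma cmap_cga_in w : cmap (cga_in A w) = cga_in B w.
Proof.
by apply: cring_ext => n; rewrite /cmap /cga_in bc_map_pure rmorph1.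
Qed.

Fact cga_in_additive : zmod_morphism (cga_in A : cring Om -> _).
Proof.
move=> a b; apply: (addIr (cga_in A b)); rewrite subrK.
apply: cring_ext => n; rewrite cringDE /cga_in /bpure -tpureDr.
congr (tpure _ _); exact: (congr1 (fun c : cring Om => c n) (subrK b a)).
Qed.
Lemma cga_in_cst (s : k) : cga_in A (cring_cst Om s) = cring_cst _ (alg_map A s).
Proof.
apply: cring_ext => -[|n]; rewrite /cga_in.
  by rewrite !cring_cst0 bcZ_pure /bpure -tpureZ amodZE.
by rewrite !cring_cstS; apply: additive_at0 => *; exact: tpureDr.
Qed.
Fact cga_in_mult : monoid_morphism (cga_in A : cring Om -> _).
Proof.
split=> [|a b].
  by rewrite -[1](rmorph1 (cring_cst Om)) cga_in_cst !rmorph1.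
apply: cring_ext => n; rewrite /cga_in !cringME /bpure tpure_sumr.
by apply: eq_bigr => i _; rewrite /= bc_cga_mul_pure mulr1.
Qed.
HB.instance Definition _ :=
  GRing.isZmodMorphism.Build _ _ (cga_in A : cring Om -> _) cga_in_additive.
HB.instance Definition _ :=
  GRing.isMonoidMorphism.Build _ _ (cga_in A : cring Om -> _) cga_in_mult.
End CgaFunctoriality.

(** * Theta as a homomorphism of algebras over F *)

Section Twist.
Variables (K F : fieldType) (iota : {rmorphism K -> F}) (Om : cga F).
Variable theta : @iter_hder K (baseF iota) Om.

(* A ⊗ Om as an F-algebra through theta, so that theta_A is F-linear *)
Definition twist (A : alg F) : alg F :=
  @Alg F (cring (bc_cga A Om)) (cga_in A \o theta).

Fact cmap_twistK (A B : alg F) (f : ahom A B) t :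
  cmap f (alg_map (twist A) t) = alg_map (twist B) t.
Proof. exact: cmap_cga_in. Qed.
Definition cmap_twist (A B : alg F) (f : ahom A B) : ahom (twist A) (twist B) :=
  @AHom F (twist A) (twist B) (cmap f) (cmap_twistK f).

Variable R : theta_ring theta.

Definition theta_twist : ahom R (twist R) :=
  @AHom F R (twist R) (tr_theta R) (@tr_theta_ext _ _ _ _ _ R).
End Twist.

(** * Theta-simple rings *)

Section ThetaOperators.
Variables (K F : fieldType) (iota : {rmorphism K -> F}) (Om : cga F).
Variables (theta : @iter_hder K (baseF iota) Om) (R : theta_ring theta).

Lemma theta_deg0 (r : R) : tr_theta R r 0%N = bpure r (cga_one Om).
Proof. by rewrite (hd_deg0 (tr_theta R)) /= bcZ_pure mulr1. Qed.

Lemma theta_cstM (c : K) (r : R) n :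
  tr_theta R (alg_map R (iota c) * r) n = alg_map R (iota c) *: tr_theta R r n.
Proof.
have -> : tr_theta R (alg_map R (iota c) * r) =
    cring_cst (bc_cga R Om) (alg_map R (iota c)) * tr_theta R r.
  by rewrite rmorphM; congr (_ * _); exact: (ahomK (tr_theta R) c).
exact: cring_cstM.
Qed.

(* K-linear endomorphisms of R that detect theta-ideals and constants, so that
   Om can be forgotten. *)
Definition theta_index : Type := {n : nat & {linear Om n.+1 -> F^o}}.
Definition theta_op_fun (i : theta_index) (r : amod (RK R)) : amod (RK R) :=
  rcontr (tagged i) (tr_theta R r (tag i).+1).

Fact theta_op_linear i : linear (theta_op_fun i).
Proof.
move=> c x y; rewrite /theta_op_fun !amodZE rmorphD cringDE rcontrD.
by rewrite theta_cstM bc_contrZ.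
Qed.
HB.instance Definition _ i := GRing.isLinear.Build K (amod (RK R)) (amod (RK R))
  *:%R (theta_op_fun i) (theta_op_linear i).
Definition theta_op i : {linear amod (RK R) -> amod (RK R)} := theta_op_fun i.

(** Here it matters that the operators come from positive degrees only: in degree 0 a contraction of
    theta is multiplication by a scalar. *)
Lemma theta_op1 i : theta_op i (1 : R) = 0.
Proof.
rewrite /theta_op /= /theta_op_fun.
have -> : tr_theta R 1 = cring_cst (bc_cga R Om) 1 by rewrite !rmorph1.
by rewrite cring_cstS rcontr0.
Qed.

(** A dual expansion writes each positive component of theta at [r] as a sum of terms
    [theta_op i r ⊗ v], and the degree 0 component is [r ⊗ 1]. Hence an ideal stable under the
    operators is a theta-ideal. *)
Lemma theta_op_simple : theta_simple R -> forall I : R -> Prop, is_ideal I ->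
  (forall i r, I r -> I (theta_op i r)) -> (forall r, I r -> r = 0) \/ forall r, I r.
Proof.
move=> Rsimple I Iideal Istable; apply: Rsimple; split=> // -[|n] r Ir.
  exists [:: (r, cga_one Om)]; last by rewrite big_seq1 theta_deg0.
  by move=> p; rewrite inE => /eqP ->.
have [s ->] := rcontr_dual (tr_theta R r n.+1).
elim: s => [|p s [s' s'I s'E]]; first by exists [::]; rewrite ?big_nil.
exists ((rcontr p.2 (tr_theta R r n.+1) : R, p.1) :: s') => [q|].
  rewrite inE => /orP[/eqP-> /=|]; last exact: s'I.
  exact: Istable (existT (fun n => {linear Om n.+1 -> F^o}) n p.2) r Ir.
by rewrite !big_cons s'E.
Qed.

Lemma theta_op_const (r : R) : (forall i, theta_op i r = 0) -> is_const r.
Proof.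
move=> r0; apply: cring_ext => -[|n].
  by rewrite theta_deg0 cring_cst0 bcZ_pure mulr1.
rewrite cring_cstS; apply: rcontr_eq0 => lam.
exact: r0 (existT (fun n => {linear Om n.+1 -> F^o}) n lam).
Qed.

(** * Extension of theta to R ⊗_K L *)

Section Extension.
Variable L : alg K.
Local Notation RL := (extRF R L).

Fact const_twistK (c : K) :
  cring_cst (bc_cga RL Om) (in2 (RK R) L (alg_map L c)) =
  alg_map (twist theta RL) (iota c).
Proof.
rewrite -[RHS]/(cga_in RL (theta (iota c))).
have -> : theta (iota c) = cring_cst Om (iota c) by exact: (ahomK theta c).
by rewrite cga_in_cst ahomK -R_extK.
Qed.
Definition const_twist : ahom L (res iota (twist theta RL)) :=
  @AHom K L (res iota (twist theta RL)) (cring_cst (bc_cga RL Om) \o in2 (RK R) L)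
    const_twistK.

(** The function [ext_theta] again, now obtained from the universal property of the tensor product
    and hence known to be a ring homomorphism. *)
Definition theta_ext : ahom (atens (RK R) L) (res iota (twist theta RL)) :=
  copair (ahom_res iota (ahom_comp (cmap_twist theta (R_ext R L)) (theta_twist R)))
         const_twist.

Lemma theta_extE (x : extR R L) : ext_theta x = theta_ext x.
Proof.
apply: cring_ext => n; move: x; apply: tens_ext => [x y|x y|r a].
- apply: tliftD; split=> [r r' a|r a a'|c r a].
  + by rewrite rmorphD cringDE bc_mapD scalerDr.
  + by rewrite rmorphD scalerDl.
  rewrite !amodZE theta_cstM bc_mapZ scalerA rmorphM mulrC; congr (_ * _ *: _).
  by rewrite [RHS]ahomK.
- by rewrite rmorphD.
rewrite -/(apure _ _) ext_theta_pure apureE rmorphM copair_in1 copair_in2.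
by rewrite mulrC; apply/esym; exact: cring_cstM.
Qed.

Lemma ext_theta_in1 r : ext_theta (in1 (RK R) L r : extR R L) =
  cmap (R_ext R L) (tr_theta R r).
Proof. by rewrite theta_extE /theta_ext copair_in1. Qed.

Lemma ext_theta_in2 a : ext_theta (in2 (RK R) L a : extR R L) =
  cring_cst (bc_cga RL Om) (in2 (RK R) L a).
Proof. by rewrite theta_extE /theta_ext copair_in2. Qed.

(** This is the bridge to the algebras with operators: on [R ⊗_K L], contracting theta amounts to
    applying [theta_op i] to the first factor, so that [L] is a mere vector space. *)
Lemma rcontr_ext_theta i (x : extR R L) :
  rcontr (tagged i) (ext_theta x (tag i).+1) = lmap (theta_op i) x :> RL.
Proof.
move: x; apply: tens_ext => [x y|x y|r a].
- by rewrite !theta_extE rmorphD cringDE rcontrD.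
- by rewrite lmapD.
rewrite lmap_pure -!/(apure _ _) ext_theta_pure bc_contrZ bc_contr_map mulrC.
by rewrite [RHS]apureE.
Qed.
End Extension.

Hypothesis R_simple : theta_simple R.
Hypothesis R_const : forall r : R, is_const r -> exists c : K, r = alg_map R (iota c).

Lemma theta_op_const_base r : (forall i, theta_op i r = 0) ->
  exists c, r = alg_map (RK R) c.
Proof. by move/theta_op_const/R_const. Qed.

(** All [theta_op i ⊗ id] kill such an [x], and [const_bc] applies. *)
Lemma const_ext (L : alg K) (x : extR R L) :
  ext_theta x = cring_cst (bc_cga (extRF R L) Om) x -> exists a, x = in2 (RK R) L a.
Proof.
move=> xc.
have [i|a ->] := @const_bc K (RK R) _ theta_op theta_op_const_base (amod L) x;
  last by exists a.
rewrite -[LHS]rcontr_ext_theta xc cring_cstS.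
exact: (rcontr0 (amod (extRF R L)) (tagged i)).
Qed.

(** By the first hypothesis the kernel of [f] is a stable submodule of [R ⊗_K L]; by the second it
    contains no nonzero [1 ⊗ a]. So [stable_submod_eq0] makes it zero. *)
Lemma ext_inj (L : alg K) (B : alg F) (f : ahom (extRF R L) B) :
  (forall x : extR R L, f x = 0 -> cmap (Om := Om) f (ext_theta x) = 0) ->
  injective (f \o in2 (RK R) L) -> injective f.
Proof.
move=> ftheta finj; suff f0 x : f x = 0 -> x = 0.
  move=> x y fxy; apply/eqP; rewrite -subr_eq0; apply/eqP/f0.
  by rewrite rmorphB fxy subrr.
move: x; apply: (@stable_submod_eq0 K (RK R) _ theta_op theta_op1
    (theta_op_simple R_simple) theta_op_const_base (amod L) (fun x => f x = 0)).
- split=> [|x y fx fy|r x fx|i x fx].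
  + exact: rmorph0.
  + by rewrite (rmorphD f) fx fy addr0.
  + have -> : r *: x = in1 (RK R) L r * (x : extRF R L).
      move: x {fx}; apply: tens_ext => [x y|x y|r' a].
      * by rewrite scalerDr.
      * by rewrite mulrDr.
      by rewrite -/(bpure _ _) bcZ_pure -/(apure _ _) [RHS]apureM mul1r.
    by rewrite rmorphM fx mulr0.
  rewrite -rcontr_ext_theta -bc_contr_map.
  have /(congr1 (fun c : cring _ => c (tag i).+1)) := ftheta x fx.
  by rewrite /cmap => ->; exact: (rcontr0 (amod B) (tagged i)).
by move=> a fa; apply: finj; rewrite /= [in RHS]raddf0 rmorph0.
Qed.
End ThetaOperators.

(** * Equalizers and constant matrices *)

Lemma ahom_factor (k : comPzRingType) (A B C : alg k) (f : ahom A C) (h : ahom B C) :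
  injective f -> (forall b, exists a, f a = h b) ->
  exists g : ahom B A, forall b, f (g b) = h b.
Proof.
move=> finj /choice[g fg].
have gD : zmod_morphism g by move=> x y; apply: finj; rewrite rmorphB !fg rmorphB.
have gM : monoid_morphism g.
  split=> [|x y]; apply: finj; first by rewrite fg !rmorph1.
  by rewrite rmorphM !fg rmorphM.
pose ga := GRing.isZmodMorphism.Build B A g gD.
pose gm := GRing.isMonoidMorphism.Build B A g gM.
pose g' : {rmorphism B -> A} := HB.pack g ga gm.
have g'K c : g' (alg_map B c) = alg_map A c by apply: finj; rewrite ahomK fg ahomK.
by exists (AHom g'K).
Qed.

Section Equalizer.
Variables (A B : comPzRingType) (f g : {rmorphism A -> B}).

Definition equal_pred : {pred A} := fun x => f x == g x.
Fact equal_pred_subring : subring_closed equal_pred.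
Proof.
split=> [|x y /eqP fx /eqP fy|x y /eqP fx /eqP fy]; apply/eqP.
- by rewrite !rmorph1.
- by rewrite !rmorphB fx fy.
- by rewrite !rmorphM fx fy.
Qed.
(** Taken for theta and the inclusion of scalars, this subring becomes the ring of constants of
    [R ⊗_F R]. *)
Record equalizer := Equalizer { equal_val : A; equal_valP : equal_val \in equal_pred }.
HB.instance Definition _ := [isSub for equal_val].
HB.instance Definition _ := [Choice of equalizer by <:].
HB.instance Definition _ :=
  GRing.SubChoice_isSubComPzRing.Build A equal_pred equalizer equal_pred_subring.

Definition equal_inc : {rmorphism equalizer -> A} := val.

Lemma equal_incP x : f (equal_inc x) = g (equal_inc x).
Proof. exact/eqP/equal_valP. Qed.
Lemma equal_inc_inj : injective equal_inc.
Proof. exact: val_inj. Qed.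
Lemma equal_inc_mx n (M : 'M[A]_n) : map_mx f M = map_mx g M ->
  exists N, map_mx equal_inc N = M.
Proof.
move=> fgM; have MP i j : M i j \in equal_pred.
  by apply/eqP; move/matrixP/(_ i j): fgM; rewrite !mxE.
exists (\matrix_(i, j) Equalizer (MP i j)).
by apply/matrixP => i j; rewrite !mxE.
Qed.

Section Lift.
Variables (T : comPzRingType) (h : {rmorphism T -> A}).
Hypothesis fgh : forall t, f (h t) = g (h t).

Definition equal_lift_fun (t : T) : equalizer := Equalizer (introT eqP (fgh t)).
Fact equal_lift_additive : zmod_morphism equal_lift_fun.
Proof. by move=> x y; apply: equal_inc_inj; rewrite rmorphB; exact: rmorphB. Qed.
Fact equal_lift_mult : monoid_morphism equal_lift_fun.
Proof.
split=> [|x y]; apply: equal_inc_inj; first by rewrite rmorph1; exact: rmorph1.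
by rewrite rmorphM; exact: rmorphM.
Qed.
HB.instance Definition _ :=
  GRing.isZmodMorphism.Build _ _ equal_lift_fun equal_lift_additive.
HB.instance Definition _ :=
  GRing.isMonoidMorphism.Build _ _ equal_lift_fun equal_lift_mult.
Definition equal_lift : {rmorphism T -> equalizer} := equal_lift_fun.
End Lift.
End Equalizer.

Lemma mulmx_adj_inv (A : comPzRingType) n (M : 'M[A]_n) d : d * \det M = 1 ->
  M *m (d *: \adj M) = 1%:M /\ (d *: \adj M) *m M = 1%:M.
Proof.
move=> dM; rewrite -scalemxAr -scalemxAl mul_mx_adj mul_adj_mx.
by rewrite scale_scalar_mx dM.
Qed.

(** Used to show that a range contains the image of all of [R]: the entries of [g Y] are
    combinations of values of [h] with coefficients in the range, and the inverse determinant is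
    recovered from [V]. *)
Lemma range_generated (F : comPzRingType) (R : alg F) (T0 T : comPzRingType)
    (f : {rmorphism T0 -> T}) (g h : {rmorphism R -> T}) n (Y : 'M[R]_n) d
    (U V : 'M[T0]_n) :
  d * \det Y = 1 -> alg_generated (fun r => r = d \/ exists i j, r = Y i j) ->
  (forall t, exists x, f x = g (alg_map R t)) -> (forall r, exists x, f x = h r) ->
  map_mx g Y = map_mx h Y *m map_mx f U ->
  map_mx h Y = map_mx g Y *m map_mx f V ->
  forall r, exists x, f x = g r.
Proof.
move=> dY Rgen fF fh gU hV; apply: Rgen => [r [->|[i [j ->]]]|//|r r'|r r'].
(* Multiply the determinant of [hV] by [g d * h d]. *)
- have gd : g d = h d * f (\det V).
    have /(congr1 (fun M => g d * h d * \det M)) := hV.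
    rewrite det_mulmx !det_map_mx -mulrA -rmorphM dY rmorph1 mulr1 => ->.
    by rewrite [g d * h d]mulrC -!mulrA [g d * _]mulrA -rmorphM dY rmorph1 mul1r.
  by have [x xE] := fh d; exists (x * \det V); rewrite gd rmorphM xE.
- move/matrixP/(_ i j): gU; rewrite !mxE => ->.
  have [y yE] := choice fh; exists (\sum_l y (Y i l) * U l j).
  by rewrite rmorph_sum; apply: eq_bigr => l _; rewrite rmorphM yE !mxE.
- by move=> [x xE] [y yE]; exists (x + y); rewrite !rmorphD xE yE.
- by move=> [x xE] [y yE]; exists (x * y); rewrite !rmorphM xE yE.
Qed.

Section ThetaCompat.
Variables (K F : fieldType) (iota : {rmorphism K -> F}) (Om : cga F).
Variables (theta : @iter_hder K (baseF iota) Om) (R : theta_ring theta).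
Variables (L : alg K) (B : alg F) (f : ahom (extRF R L) B).
Variable tB : {rmorphism B -> cring (bc_cga B Om)}.
Hypothesis f1 : forall r,
  tB (f (in1 (RK R) L r)) = cmap (ahom_comp f (R_ext R L)) (tr_theta R r).
Hypothesis f2 : forall a,
  tB (f (in2 (RK R) L a)) = cring_cst _ (f (in2 (RK R) L a)).

(** Both sides are ring homomorphisms in [x], so it is enough to compare them on the two factors,
    which is what [f1] and [f2] do. *)
Lemma ext_theta_compat (x : extR R L) : tB (f x) = cmap f (ext_theta x).
Proof.
rewrite theta_extE; move: x; apply: (@atens_ext K (RK R) L _
  (tB \o f : {rmorphism atens_ring _ _ -> _}) (cmap f \o @theta_ext _ _ _ _ _ R L)).
- move=> r; rewrite /= -/(in1_fun _ _) f1 -theta_extE ext_theta_in1.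
  by apply: cring_ext => n; rewrite /cmap bc_map_comp.
- by move=> a; rewrite /= f2 -theta_extE ext_theta_in2 cmap_cst.
Qed.
End ThetaCompat.

(** * The constants of R ⊗_F R *)

Section Endomorphism.
Variables (K F : fieldType) (iota : {rmorphism K -> F}) (Om : cga F).
Variables (theta : @iter_hder K (baseF iota) Om) (R : theta_ring theta).
Variables (L : alg K) (s : ahom R (extRF R L)).

Lemma extR_map_in1 t :
  alg_map (extR R L) (in1 (baseF iota) L t) = in1 (RK R) L (alg_map R t).
Proof. exact: (esym (R_extK R L t)). Qed.
Lemma extR_map_in2 a :
  alg_map (extR R L) (in2 (baseF iota) L a) = in2 (RK R) L a.
Proof.
exact: (copair_in2 (ahom_comp (in1 (RK R) L) (baseF_R R))
  (ahom_comp (in2 (RK R) L) (ahom_id L)) a).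
Qed.

Fact ext_endo_baseK c : s (alg_map (RK R) c) = alg_map (atens (RK R) L) c.
Proof. by rewrite (ahomK s (iota c)) -R_extK. Qed.
Definition ext_endo_K : ahom (atens (RK R) L) (atens (RK R) L) :=
  copair (@AHom K (RK R) (atens (RK R) L) s ext_endo_baseK) (in2 (RK R) L).
Lemma ext_endo_in1 r : ext_endo_K (in1 (RK R) L r) = s r.
Proof. by rewrite /ext_endo_K copair_in1. Qed.
Lemma ext_endo_in2 a : ext_endo_K (in2 (RK R) L a) = in2 (RK R) L a.
Proof. by rewrite /ext_endo_K copair_in2. Qed.
Fact ext_endoK t : ext_endo_K (alg_map (extR R L) t) = alg_map (extR R L) t.
Proof.
move: t; apply: (@atens_ext K (baseF iota) L _
  (ext_endo_K \o alg_map (extR R L)) (alg_map (extR R L))) => a.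
  by rewrite [LHS]/= !extR_map_in1 ext_endo_in1 ahomK -R_extK.
by rewrite [LHS]/= !extR_map_in2 ext_endo_in2.
Qed.
Definition ext_endo : ahom (extR R L) (extR R L) :=
  @AHom (extF iota L) (extR R L) (extR R L) ext_endo_K ext_endoK.
End Endomorphism.

(** * The multiplication map from R ⊗_K C to R ⊗_F R *)

Section Wronskian.
Variables (K F : fieldType) (iota : {rmorphism K -> F}) (Om : cga F).
Variables (theta : @iter_hder K (baseF iota) Om) (R : theta_ring theta).

Local Notation S := (atens R R).

(** The map [a ⊗ b |-> theta(a) theta(b)]. It is well defined over [F] because both legs restrict to
    the given theta on [F], which is what the target [twist] records. *)
Definition theta_square : ahom S (twist theta S) :=
  copair (ahom_comp (cmap_twist theta (in1 R R)) (theta_twist R))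
         (ahom_comp (cmap_twist theta (in2 R R)) (theta_twist R)).

Lemma theta_square_in1 r : theta_square (in1 R R r) = cmap (in1 R R) (tr_theta R r).
Proof. by rewrite /theta_square copair_in1. Qed.
Lemma theta_square_in2 r : theta_square (in2 R R r) = cmap (in2 R R) (tr_theta R r).
Proof. by rewrite /theta_square copair_in2. Qed.

Definition square_const_ring : comPzRingType :=
  equalizer theta_square (cring_cst (bc_cga S Om)).

Fact square_const_base (c : K) :
  theta_square (alg_map S (iota c)) = cring_cst (bc_cga S Om) (alg_map S (iota c)).
Proof.
rewrite ahomK -[LHS]/(cga_in S (theta (iota c))).
have -> : theta (iota c) = cring_cst Om (iota c) by exact: (ahomK theta c).
exact: cga_in_cst.
Qed.
Definition square_const : alg K := @Alg K square_const_ring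
  (@equal_lift _ _ _ _ _ (alg_map S \o iota : {rmorphism K -> S}) square_const_base).
Local Notation C := square_const.

Definition const_inc : ahom C (res iota S) :=
  @AHom K C (res iota S) (@equal_inc _ _ theta_square (cring_cst (bc_cga S Om)))
    (fun=> erefl).

Lemma theta_const_inc c : theta_square (const_inc c) = cring_cst _ (const_inc c).
Proof. exact: equal_incP. Qed.

Definition square_mul_K : ahom (atens (RK R) C) (res iota S) :=
  copair (ahom_res iota (in1 R R)) const_inc.
Fact square_mulK t : square_mul_K (alg_map (extRF R C) t) = alg_map S t.
Proof. by rewrite -R_extK /square_mul_K copair_in1. Qed.
Definition square_mul : ahom (extRF R C) S :=
  @AHom F (extRF R C) S square_mul_K square_mulK.

Lemma square_mul_in1 r : square_mul (in1 (RK R) C r) = in1 R R r.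
Proof. by rewrite /square_mul /= -/(in1_fun _ _) copair_in1. Qed.
Lemma square_mul_in2 c : square_mul (in2 (RK R) C c) = const_inc c.
Proof. exact: (copair_in2 (ahom_res iota (in1 R R)) const_inc c). Qed.

Lemma theta_square_mul (x : extR R C) :
  theta_square (square_mul x) = cmap square_mul (ext_theta x).
Proof.
apply: (@ext_theta_compat _ _ _ _ _ R C S square_mul theta_square) => [r|c].
  rewrite square_mul_in1 theta_square_in1; apply: cring_ext => n.
  by apply: eq_bc_map => a; apply/esym; exact: square_mul_in1.
by rewrite square_mul_in2 theta_const_inc.
Qed.

Variables (n : nat) (A : 'M[cring Om]_n) (Y : 'M[R]_n) (d : R).
Hypothesis dY : d * \det Y = 1.
Hypothesis thetaY : map_mx (tr_theta R) Y =
  map_mx (cga_in R) A *m map_mx (cring_cst (bc_cga R Om)) Y.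
Hypothesis R_gen : @alg_generated F R (fun r => r = d \/ exists i j, r = Y i j).

Lemma cmap_theta_mx (f : ahom R S) :
  map_mx (fun r => cmap f (tr_theta R r)) Y =
  map_mx (cga_in S) A *m map_mx (cring_cst (bc_cga S Om)) (map_mx f Y).
Proof.
rewrite -[LHS]/(map_mx (cmap f \o tr_theta R) Y) map_mx_comp thetaY map_mxM.
rewrite -!map_mx_comp.
by congr (_ *m _); apply: eq_map_mx => a /=; rewrite ?cmap_cga_in ?cmap_cst.
Qed.

(** Since [theta(M) = A M] and [theta(N) = A N], the matrix [M^-1 N] is fixed by theta:
    [(A M)^-1 (A N) = M^-1 N]. *)
Lemma const_quotient (M N : 'M[S]_n) (e : S) : e * \det M = 1 ->
  map_mx theta_square M =
    map_mx (cga_in S) A *m map_mx (cring_cst (bc_cga S Om)) M ->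
  map_mx theta_square N =
    map_mx (cga_in S) A *m map_mx (cring_cst (bc_cga S Om)) N ->
  exists W : 'M[C]_n, N = M *m map_mx const_inc W.
Proof.
move=> eM thetaM thetaN; have [MV VM] := mulmx_adj_inv eM.
set V := e *: \adj M in MV VM.
have NE : N = M *m (V *m N) by rewrite mulmxA MV mul1mx.
have [W WE] : exists W : 'M[C]_n, map_mx const_inc W = V *m N.
  apply: equal_inc_mx; rewrite -[LHS]mul1mx -[RHS]mul1mx.
  (* After cancelling the invertible matrix [theta(M)], both sides equal [A N]. *)
  rewrite -(map_mx1 theta_square) -VM !(map_mxM theta_square) -!mulmxA.
  congr (_ *m _); rewrite !mulmxA -(map_mxM theta_square) MV map_mx1 mul1mx.
  by rewrite thetaN thetaM -mulmxA -map_mxM -NE.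
by exists W; rewrite WE.
Qed.

(** [Y ⊗ 1] and [1 ⊗ Y] are invertible solutions of one equation over [R ⊗_F R]; apply
    [const_quotient] in both directions. *)
Lemma exists_wronskian : exists U V : 'M[C]_n,
  map_mx (in2 R R) Y = map_mx (in1 R R) Y *m map_mx const_inc U /\
  map_mx (in1 R R) Y = map_mx (in2 R R) Y *m map_mx const_inc V.
Proof.
have det_in (f : ahom R S) : f d * \det (map_mx f Y) = 1.
  by rewrite det_map_mx -rmorphM dY rmorph1.
have theta1 : map_mx theta_square (map_mx (in1 R R) Y) =
    map_mx (cga_in S) A *m map_mx (cring_cst (bc_cga S Om)) (map_mx (in1 R R) Y).
  rewrite -cmap_theta_mx -map_mx_comp; apply: eq_map_mx => r.
  exact: theta_square_in1.
have theta2 : map_mx theta_square (map_mx (in2 R R) Y) =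
    map_mx (cga_in S) A *m map_mx (cring_cst (bc_cga S Om)) (map_mx (in2 R R) Y).
  rewrite -cmap_theta_mx -map_mx_comp; apply: eq_map_mx => r.
  exact: theta_square_in2.
have [U UE] := const_quotient (det_in (in1 R R)) theta1 theta2.
have [V VE] := const_quotient (det_in (in2 R R)) theta2 theta1.
by exists U, V.
Qed.

Hypothesis R_simple : theta_simple R.
Hypothesis R_const : forall r : R, is_const r -> exists c : K, r = alg_map R (iota c).

Lemma square_mul_inj : injective square_mul.
Proof.
apply: (ext_inj R_simple R_const) => [x x0|c c'].
  by rewrite -theta_square_mul x0 rmorph0.
by rewrite /= !square_mul_in2 => /equal_inc_inj.
Qed.

(** The range contains [R ⊗ 1] and the constants, hence the entries of [1 ⊗ Y = (Y ⊗ 1) U], and then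
    all of [1 ⊗ R]. *)
Lemma square_mul_surj s : exists x, square_mul x = s.
Proof.
have [U [V [UE VE]]] := exists_wronskian.
have rU (W : 'M[C]_n) :
    map_mx square_mul (map_mx (in2 (RK R) C) W) = map_mx const_inc W.
  by rewrite -map_mx_comp; apply: eq_map_mx => c; exact: square_mul_in2.
have r1 r : exists x, square_mul x = in1 R R r.
  by exists (in1 (RK R) C r); exact: square_mul_in1.
have r2 : forall r, exists x, square_mul x = in2 R R r.
  apply: (range_generated dY R_gen _ r1 (U := map_mx (in2 (RK R) C) U)
      (V := map_mx (in2 (RK R) C) V)); rewrite ?rU // => t.
  by exists (alg_map (extRF R C) t); rewrite ahomK; exact: (ahomK square_mul t).
elim/tens_ind: s => [|a b|x y [x' <-] [y' <-]]; first by exists 0; rewrite rmorph0.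
  have [x xE] := r1 a; have [y yE] := r2 b; exists (x * y).
  by rewrite rmorphM xE yE -apureE.
by exists (x' + y'); rewrite rmorphD.
Qed.

End Wronskian.

Lemma cmap_cancel (k : comPzRingType) (Om : cga k) (A B : alg k)
    (f : ahom A B) (g : ahom B A) :
  cancel f g -> cancel (cmap (Om := Om) f) (cmap g).
Proof.
move=> fK a; apply: cring_ext => n; rewrite /cmap bc_map_comp.
rewrite -[RHS]bc_map_id; exact: eq_bc_map.
Qed.

Lemma in2_inj (k : fieldType) (A B : alg k) : (1 : A) <> 0 -> injective (in2 A B).
Proof.
move=> /(@exists_functional k (amod A) 1)[lam lam1].
suff bK : cancel (in2 A B) (lcontr lam) by exact: can_inj bK.
by move=> b; rewrite [LHS]lcontr_pure lam1 scale1r.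
Qed.

Lemma atens_map_in1 (k : comPzRingType) (A A' B B' : alg k) (f : ahom A A')
    (g : ahom B B') a : atens_map f g (in1 A B a) = in1 A' B' (f a).
Proof. by rewrite /atens_map copair_in1. Qed.
Lemma atens_map_in2 (k : comPzRingType) (A A' B B' : alg k) (f : ahom A A')
    (g : ahom B B') b : atens_map f g (in2 A B b) = in2 A' B' (g b).
Proof. by rewrite /atens_map copair_in2. Qed.

(** * The theta-automorphism of R_C coming from the second factor *)

Section Torsor.
Variables (K F : fieldType) (iota : {rmorphism K -> F}) (Om : cga F).
Variables (theta : @iter_hder K (baseF iota) Om) (R : theta_ring theta).

Lemma extR_ext (L : alg K) (T : comPzRingType) (f g : {rmorphism extR R L -> T}) :
  (forall r, f (in1 (RK R) L r) = g (in1 (RK R) L r)) ->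
  (forall a, f (in2 (RK R) L a) = g (in2 (RK R) L a)) -> f =1 g.
Proof. exact: (@atens_ext K (RK R) L T f g). Qed.

Lemma extR_ahom_in2 (L : alg K) (f : ahom (extR R L) (extR R L)) a :
  f (in2 (RK R) L a) = in2 (RK R) L a.
Proof. by rewrite -extR_map_in2 ahomK. Qed.

Lemma exists_square_aut n (A : 'M[cring Om]_n) (Y : 'M[R]_n) (d : R) :
  d * \det Y = 1 ->
  map_mx (tr_theta R) Y =
    map_mx (cga_in R) A *m map_mx (cring_cst (bc_cga R Om)) Y ->
  @alg_generated F R (fun r => r = d \/ exists i j, r = Y i j) ->
  theta_simple R ->
  (forall r : R, is_const r -> exists c : K, r = alg_map R (iota c)) ->
  exists (inv : ahom (atens R R) (extRF R (square_const R)))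
         (sg : theta_aut R (square_const R)),
    [/\ cancel (square_mul R) inv, cancel inv (square_mul R)
      & forall r, sg (in1 (RK R) _ r) = inv (in2 R R r)].
Proof.
move=> dY thetaY R_gen R_simple R_const; set C := square_const R.
pose mu := square_mul R.
have mu_inj : injective mu := square_mul_inj R_simple R_const.
have mu_surj s : exists x, mu x = ahom_id (atens R R) s.
  exact: square_mul_surj dY thetaY R_gen s.
have [inv invK] := ahom_factor mu_inj mu_surj.
have muK : cancel mu inv by move=> x; apply: mu_inj; exact: invK.
pose s : ahom R (extRF R C) := ahom_comp inv (in2 R R).
pose sC := ext_endo s.
have sC1 r : sC (in1 (RK R) C r) = s r by exact: ext_endo_in1.
have sC2 c : sC (in2 (RK R) C c) = in2 (RK R) C c by exact: ext_endo_in2.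
(* The isomorphism [mu] commutes with theta, hence so does its inverse. *)
have s_theta r : ext_theta (s r) = cmap s (tr_theta R r).
  rewrite -[LHS](cmap_cancel (Om := Om) muK) -theta_square_mul.
  rewrite [square_mul R _]invK theta_square_in2.
  by apply: cring_ext => m; rewrite /cmap bc_map_comp.
have sC_theta (x : extR R C) :
    ext_theta (sC x) = cmap (ahom_res (in1 (baseF iota) C) sC) (ext_theta x).
  rewrite theta_extE.
  apply: (@ext_theta_compat _ _ _ _ _ R C (extRF R C)
    (ahom_res (in1 (baseF iota) C) sC) (@theta_ext _ _ _ _ _ R C)) => [r|c].
    rewrite -theta_extE [ahom_res _ _ _]sC1 s_theta; apply: cring_ext => m.
    by apply: eq_bc_map => a; apply/esym; exact: sC1.
  by rewrite -theta_extE [ahom_res _ _ _]sC2 ext_theta_in2.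
(* The kernel argument again: [sC] commutes with theta and is the identity on [C]. *)
have sC_inj : injective sC.
  apply: (ext_inj R_simple R_const (f := ahom_res (in1 (baseF iota) C) sC)).
    by move=> x x0; rewrite -sC_theta [sC x]x0 theta_extE rmorph0.
  move=> c c'; rewrite /= !sC2 => /(congr1 mu).
  by rewrite /mu !square_mul_in2 => /equal_inc_inj.
have [U [V [UE VE]]] := exists_wronskian dY thetaY.
have sC_surj : forall x, exists y, sC y = x.
  have rU (W : 'M[C]_n) : map_mx mu (map_mx (in2 (RK R) C) W) = map_mx (const_inc R) W.
    by rewrite -map_mx_comp; apply: eq_map_mx => c; exact: square_mul_in2.
  have sU (W : 'M[C]_n) : map_mx sC (map_mx (in2 (RK R) C) W) = map_mx (in2 (RK R) C) W.
    by rewrite -map_mx_comp; apply: eq_map_mx.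
  have mu1 : map_mx mu (map_mx (R_ext R C) Y) = map_mx (in1 R R) Y.
    by rewrite -map_mx_comp; apply: eq_map_mx => r; exact: square_mul_in1.
  have mu2 : map_mx mu (map_mx s Y) = map_mx (in2 R R) Y.
    by rewrite -map_mx_comp; apply: eq_map_mx => r; exact: invK.
  have mu_mx (M N : 'M[extRF R C]_n) : map_mx mu M = map_mx mu N -> M = N.
    move=> MN; apply/matrixP => i j; apply: mu_inj.
    by move/matrixP/(_ i j): MN; rewrite !mxE.
  (* Pulled back along [mu], the two relations read [s(Y) = Y U] and [Y = s(Y) V]. Here [Y] is to be
     recovered from [s(Y)], so [U] and [V] trade places; [sC] fixes their entries. *)
  have r1 : forall r, exists y, sC y = R_ext R C r.
    apply: (range_generated (f := sC) (h := s) dY R_gen (U := map_mx (in2 (RK R) C) V)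
      (V := map_mx (in2 (RK R) C) U)) => [t|r||].
    - exists (alg_map (extRF R C) t).
      exact: etrans (ahomK sC (in1 (baseF iota) C t)) (esym (ahomK (R_ext R C) t)).
    - by exists (in1 (RK R) C r).
    - by rewrite sU; apply: mu_mx; rewrite map_mxM rU mu1 mu2.
    - by rewrite sU; apply: mu_mx; rewrite map_mxM rU mu1 mu2.
  elim/tens_ind=> [|a c|x y [x' <-] [y' <-]]; first by exists 0; rewrite rmorph0.
    have [y yE] := r1 a; exists (y * in2 (RK R) C c).
    by rewrite rmorphM yE sC2 -apureE.
  by exists (x' + y'); rewrite rmorphD.
have sC_bij : bijective sC.
  by have [g sCg] := choice sC_surj; exists g => // x; apply: sC_inj.
exists inv, (@ThetaAut _ _ _ _ _ R C sC sC_bij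
  (fun x m => congr1 (fun a : cring _ => a m) (sC_theta x))).
by split.
Qed.
End Torsor.

(** * The torsor *)

Section GaloisPoints.
Variables (K F : fieldType) (iota : {rmorphism K -> F}) (Om : cga F).
Variables (theta : @iter_hder K (baseF iota) Om) (R : theta_ring theta).
Variable G : galois_group_scheme R.

Lemma eq_gal_aut (L : alg K) (f g : ahom G L) : f =1 g -> gal_aut f =1 gal_aut g.
Proof. by move=> fg; apply/gal_aut_inj. Qed.

(** Yoneda: by naturality the automorphism attached to [f] is the image under [f] of that of the
    universal point, whose restriction to [R] is the coaction. *)
Lemma gal_aut_in1 (L : alg K) (f : ahom G L) r :
  gal_aut f (in1 (RK R) L r) = atens_map (ahom_id (RK R)) f (gal_coact G r).
Proof.
have -> : gal_aut f (in1 (RK R) L r) =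
    gal_aut (ahom_comp f (ahom_id G)) (in1 (RK R) L r) by exact: eq_gal_aut.
have := gal_aut_nat f (ahom_id G) (in1 (RK R) G r).
by rewrite [X in gal_aut _ X]atens_map_in1.
Qed.

Definition point_ev (A : alg F) (x : ahom R A) :
    ahom (atens (RK R) (res iota A)) (res iota A) :=
  copair (ahom_res iota x) (ahom_id (res iota A)).

(** This turns the action on points into automorphisms: [x.g] is the automorphism of [g] restricted
    to [R], followed by evaluation at [x]. The axioms of an action then follow from the group law on
    automorphisms. *)
Lemma point_actE (A : alg F) (x : ahom R A) (g : ahom (gs_ext iota G) A) r :
  point_act (gal_action G) x g r =
  point_ev x (gal_aut (ext_restr g) (in1 (RK R) (res iota A) r)).
Proof.
rewrite gal_aut_in1.
rewrite -[LHS]/(copair x g (ext_regroup G (gal_coact G r))).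
move: (gal_coact G r); apply: (@atens_ext K (RK R) G A (copair x g \o ext_regroup G)
  (point_ev x \o atens_map (ahom_id (RK R)) (ext_restr g))) => a.
  rewrite [RHS]/= -/(in1_fun _ _) atens_map_in1 [RHS]copair_in1.
  by rewrite /= copair_in1 [LHS]copair_in1.
rewrite [RHS]/= -/(in2_fun _ _) atens_map_in2 [RHS]copair_in2.
by rewrite /= copair_in2 [LHS]copair_in2.
Qed.

Lemma point_ev_act (A : alg F) (x : ahom R A) (g : ahom (gs_ext iota G) A) y :
  point_ev (point_act (gal_action G) x g) y = point_ev x (gal_aut (ext_restr g) y).
Proof.
move: y; apply: (@extR_ext _ _ _ _ _ R (res iota A) A
  (point_ev (point_act (gal_action G) x g)) (point_ev x \o gal_aut (ext_restr g))) => a.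
  by rewrite [RHS]/= -point_actE [LHS]copair_in1.
by rewrite [RHS]/= extR_ahom_in2 [LHS]copair_in2 [RHS]copair_in2.
Qed.

Lemma gal_action_mul (A : alg F) (x : ahom R A) (g h : ahom (gs_ext iota G) A) :
  point_act (gal_action G) (point_act (gal_action G) x g) h =1
  point_act (gal_action G) x (point_mul (gs_comul (gs_ext iota G)) g h).
Proof.
move=> r; rewrite !point_actE point_ev_act -[RHS]/(point_ev x _).
congr (point_ev x _); rewrite -[LHS]gal_aut_mul; apply: eq_gal_aut => a.
by apply/esym; exact: ext_point_mul.
Qed.

(** The automorphism attached to the unit is idempotent, and an idempotent bijection is the
    identity. *)
Lemma gal_aut1 (L : alg K) : gal_aut (ahom_comp (ahom_unit L) (gs_counit G)) =1 id.
Proof.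
set e := ahom_comp _ _ => x; apply: (bij_inj (ta_bij (gal_aut e))).
rewrite -[LHS]gal_aut_mul; apply: eq_gal_aut; exact: gs_mul1.
Qed.

Lemma gal_action_unit (A : alg F) (x : ahom R A) :
  point_act (gal_action G) x (ahom_comp (ahom_unit A) (gs_counit (gs_ext iota G))) =1 x.
Proof.
move=> r; rewrite point_actE.
have -> : gal_aut (ext_restr (ahom_comp (ahom_unit A) (gs_counit (gs_ext iota G))))
    (in1 (RK R) (res iota A) r) =
    gal_aut (ahom_comp (ahom_unit (res iota A)) (gs_counit G)) (in1 (RK R) _ r).
  by apply: eq_gal_aut; exact: ext_unit.
by rewrite gal_aut1 [LHS]copair_in1.
Qed.

Fact extRF_in2K c : in2 (RK R) G (alg_map G c) = alg_map (res iota (extRF R G)) c.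
Proof. by rewrite ahomK -[RHS](R_extK R G). Qed.
Definition extRF_in2 : ahom G (res iota (extRF R G)) :=
  @AHom K G (res iota (extRF R G)) (in2 (RK R) G) extRF_in2K.
Definition regroup_inv : ahom (atens R (ext_alg iota G)) (extRF R G) :=
  copair (R_ext R G) (ext_lift extRF_in2).

Lemma regroup_bij : bijective (ext_regroup G).
Proof.
exists regroup_inv.
  apply: (@atens_ext K (RK R) G _ (regroup_inv \o ext_regroup G) idfun) => a.
    by rewrite /= copair_in1 [LHS]copair_in1.
  by rewrite /= copair_in2 [LHS]copair_in2 ext_liftE.
apply: (@atens_ext F R (ext_alg iota G) _ (ext_regroup G \o regroup_inv) idfun) => a.
  by rewrite [LHS]/= copair_in1 [LHS]copair_in1.
move: a; apply: (@ext_alg_ext _ _ iota G (atens R (ext_alg iota G))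
  (ahom_comp (ext_regroup G) (ahom_comp regroup_inv (in2 R (ext_alg iota G))))
  (in2 R (ext_alg iota G))) => h.
rewrite -[LHS]/(ext_regroup G (regroup_inv (in2 R _ (ext_in iota G h)))).
by rewrite copair_in2 ext_liftE [LHS]copair_in2.
Qed.

(** The torsor map before [R ⊗_K K[G]] is regrouped as [R ⊗_F (F ⊗_K K[G])]. *)
Definition gal_square : ahom (atens R R) (extRF R G) :=
  copair (R_ext R G) (gal_coact G).

Lemma gal_square_in1 r : gal_square (in1 R R r) = in1 (RK R) G r.
Proof. by rewrite /gal_square copair_in1. Qed.
Lemma gal_square_in2 r : gal_square (in2 R R r) = gal_coact G r.
Proof. by rewrite /gal_square copair_in2. Qed.

(** On the second factor this is the compatibility with theta of the automorphism given by the
    universal point. *)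
Lemma gal_square_theta s :
  ext_theta (gal_square s) = cmap gal_square (theta_square R s).
Proof.
rewrite theta_extE; move: s; apply: (@atens_ext F R R _
  (@theta_ext _ _ _ _ _ R G \o gal_square) (cmap gal_square \o theta_square R)) => r.
  rewrite [LHS]/= -theta_extE [gal_square _]gal_square_in1 ext_theta_in1.
  rewrite [RHS]/= theta_square_in1; apply: cring_ext => n; rewrite /cmap bc_map_comp.
  by apply: eq_bc_map => a; apply/esym; exact: gal_square_in1.
rewrite [LHS]/= -theta_extE [gal_square _]gal_square_in2.
rewrite [RHS]/= theta_square_in2; apply: cring_ext => n; rewrite [LHS]ta_theta.
rewrite ext_theta_in1 /cmap !bc_map_comp.
by apply: eq_bc_map => a; apply/esym; exact: gal_square_in2.
Qed.

Lemma gal_action_square : copair (in1 R (gs_ext iota G)) (gal_action G) =1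
  ext_regroup G \o gal_square.
Proof.
apply: (@atens_ext F R R _ (copair (in1 R (gs_ext iota G)) (gal_action G))
  (ext_regroup G \o gal_square)) => r.
  by rewrite copair_in1 [RHS]/= [gal_square _]gal_square_in1 [RHS]copair_in1.
by rewrite copair_in2 [RHS]/= [gal_square _]gal_square_in2.
Qed.

Hypothesis R_PPV : is_PPV R.

(** In the zero ring, 0 would be the image of both 0 and 1 of [K], against the uniqueness in the
    condition on constants. *)
Lemma PPV_neq0 : (1 : R) <> 0.
Proof.
case: R_PPV => n [A [_ [_ _ Rconst]]] r0.
have /Rconst[c [_ cP]] : is_const (0 : R) by rewrite /is_const !rmorph0.
have z (x : R) : x = 0 by rewrite -[x]mul1r r0 mul0r.
have cE (c' : K) : c = c' by apply: cP; rewrite [RHS]z.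
by have /eqP := etrans (esym (cE 1)) (cE 0); rewrite oner_eq0.
Qed.

Lemma gal_square_bij : bijective gal_square.
Proof.
case: R_PPV => n [A [_ [R_simple [Y [d [dY thetaY R_gen]]] R_constP]]].
have R_const (r : R) : is_const r -> exists c : K, r = alg_map R (iota c).
  by move=> /R_constP[c [-> _]]; exists c.
have [inv [sg [muK invK sgE]]] := exists_square_aut dY thetaY R_gen R_simple R_const.
pose C := square_const R.
have in2G : injective extRF_in2 := @in2_inj K (RK R) G PPV_neq0.
(* [gal_square] commutes with theta, so it sends constants to constants of [R ⊗_K K[G]], which lie
   in [K[G]] by [const_ext]. *)
have gal_const c : exists a, extRF_in2 a =
    ahom_comp (ahom_res iota gal_square) (const_inc R) c.
  have [|a aE] := const_ext R_const (x := gal_square (const_inc R c)).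
    by rewrite gal_square_theta theta_const_inc cmap_cst.
  by exists a.
have [phi phiE] := ahom_factor in2G gal_const.
have [psi psiE] := gal_aut_surj G sg.
have phi_mu (x : extR R C) :
    gal_square (square_mul R x) = atens_map (ahom_id (RK R)) phi x.
  move: x; apply: (@extR_ext _ _ _ _ _ R C (atens (RK R) G) (gal_square \o square_mul R)
    (atens_map (ahom_id (RK R)) phi)) => a.
    rewrite [LHS]/= [square_mul R _]square_mul_in1 [gal_square _]gal_square_in1.
    by rewrite atens_map_in1.
  rewrite [LHS]/= [square_mul R _]square_mul_in2 atens_map_in2.
  exact: esym (phiE a).
have psi_coact r : atens_map (ahom_id (RK R)) psi (gal_coact G r) = inv (in2 R R r).
  by rewrite -gal_aut_in1 psiE sgE.
(* It is enough to compare automorphisms. The one of [phi psi] sends [r] to the image of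
   [mu^-1(1 ⊗ r)] under [id ⊗ phi], which by [phi_mu] is [gal_square (1 ⊗ r)], the coaction at
   [r]. *)
have phi_psi a : phi (psi a) = a.
  have /gal_aut_inj/(_ a) // : gal_aut (ahom_comp phi psi) =1 gal_aut (ahom_id G).
  apply: (@extR_ext _ _ _ _ _ R G _
    (gal_aut (ahom_comp phi psi)) (gal_aut (ahom_id G))).
    move=> r; rewrite gal_aut_in1.
    transitivity (atens_map (ahom_id (RK R)) phi
      (atens_map (ahom_id (RK R)) psi (gal_coact G r))).
      move: (gal_coact G r); apply: (@atens_ext K (RK R) G _
        (atens_map (ahom_id (RK R)) (ahom_comp phi psi))
        (atens_map (ahom_id (RK R)) phi \o atens_map (ahom_id (RK R)) psi)) => b.
        by rewrite [RHS]/= !atens_map_in1.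
      by rewrite [RHS]/= !atens_map_in2.
    by rewrite psi_coact -phi_mu invK gal_square_in2.
  by move=> b; rewrite !extR_ahom_in2.
exists (square_mul R \o atens_map (ahom_id (RK R)) psi) => [s|y].
  move: s; apply: (@atens_ext F R R _
    (square_mul R \o (atens_map (ahom_id (RK R)) psi \o gal_square)) idfun) => r.
    rewrite [LHS]/= [gal_square _]gal_square_in1 atens_map_in1.
    exact: square_mul_in1.
  by rewrite [LHS]/= [gal_square _]gal_square_in2 psi_coact [LHS]invK.
rewrite /= phi_mu; move: y; apply: (@atens_ext K (RK R) G _
  (atens_map (ahom_id (RK R)) phi \o atens_map (ahom_id (RK R)) psi) idfun) => b.
  by rewrite [LHS]/= !atens_map_in1.
by rewrite [LHS]/= !atens_map_in2 phi_psi.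
Qed.
End GaloisPoints.

Theorem corollary10p11 (K F : fieldType) (iota : {rmorphism K -> F})
  (Om : cga F)
  (Om_domain : forall a b : cring Om, a * b = 0 -> a = 0 \/ b = 0)
  (theta : @iter_hder K (baseF iota) Om)
  (constants : forall t : F,
     theta t = cring_cst Om t <-> exists c : K, t = iota c)
  (R : theta_ring theta) (R_PPV : is_PPV R)
  (G : galois_group_scheme R) :
  @is_torsor F (gs_ext iota G) R (gal_action G).
Proof.
split.
- exact: gal_action_mul.
- exact: gal_action_unit.
- exact/faithfully_flat_field/PPV_neq0.
(* The torsor map is [gal_square] followed by regrouping. *)
- have [g gK Kg] := bij_comp (regroup_bij G) (gal_square_bij G R_PPV).
  exists g => x; first by rewrite gal_action_square gK.
  by rewrite gal_action_square Kg.
Qed.
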